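(* Let $n\ge2$ and $p\in[2,\infty)$, and let $p'$ satisfy $1/p+1/p'=1$. Let $X\in\mathbb{C}^{n\times n}$ be a random Hermitian matrix such that the real random variables $\{\Re(X_{jk}),\Im(X_{jk})\}_{1\le j\le k\le n}$ are jointly independent, have zero mean, and satisfy $\|\Re(X_{jk})\|_{\psi_2}\le1$, $\|\Im(X_{jk})\|_{\psi_2}\le1$. Then (i) $\mathbb{E}\|X\|_{p',p}\le C\sqrt p\,n^{1/p}$; (ii) with probability $1-O(n^{-4})$, $\big|\|X\|_{p',p}-\mathbb{E}\|X\|_{p',p}\big|\le C\log n$. As a consequence, $\|X\|_{p',p}\le C\sqrt{p\log n}\,n^{1/p}$ with probability $1-O(n^{-4})$. Here $C>0$ is an absolute constant and the $O(\cdot)$ constants are absolute.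
   Context: $\|M\|_{p,q}:=\sup_{\|u\|_p\le1}\|Mu\|_q$. The subgaussian norm is $\|\xi\|_{\psi_2}:=\sup_{q\ge1}q^{-1/2}(\mathbb{E}|\xi|^q)^{1/q}$. *)

(* Defs.v *)
From HB Require Import structures.
From mathcomp Require Import all_boot all_order all_algebra.
From mathcomp Require Import all_classical all_reals all_analysis.
Set Implicit Arguments. Unset Strict Implicit. Unset Printing Implicit Defensive.
Import Order.TTheory GRing.Theory Num.Theory.
Import numFieldNormedType.Exports.
Local Open Scope classical_set_scope.
Local Open Scope ring_scope.

(* A complex vector u in C^n is represented by its real and imaginary parts
   (a, b) : u = a + i b.  A complex n x n matrix X by (A, B) : X = A + i B. *)

Section Defs.
Variable R : realType.

Definition cabs (a b : R) : R := Num.sqrt (a ^+ 2 + b ^+ 2).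

Definition lpnorm (n : nat) (q : R) (a b : 'I_n -> R) : R :=
  (\sum_(j < n) (cabs (a j) (b j)) `^ q) `^ q^-1.

Definition cmulv_re (n : nat) (A B : 'M[R]_n) (a b : 'I_n -> R) : 'I_n -> R :=
  fun j => \sum_(k < n) (A j k * a k - B j k * b k).
Definition cmulv_im (n : nat) (A B : 'M[R]_n) (a b : 'I_n -> R) : 'I_n -> R :=
  fun j => \sum_(k < n) (A j k * b k + B j k * a k).

Definition opnorm (n : nat) (q r : R) (A B : 'M[R]_n) : R :=
  sup [set x : R | exists a b : 'I_n -> R, lpnorm q a b <= 1 /\
                   x = lpnorm r (cmulv_re A B a b) (cmulv_im A B a b)].

Definition psi2norm d (T : measurableType d) (P : probability T R)
    (Y : T -> R) : \bar R :=
  ereal_sup [set ((q `^ (- 2^-1))%:E *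
                  (\int[P]_w ((`|Y w| `^ q)%:E)) `^ q^-1)%E
            | q in [set q : R | 1 <= q]].

Definition mutually_independent d (T : measurableType d) (P : probability T R)
    (I : finType) (D : {set I}) (Y : I -> T -> R) : Prop :=
  (forall i, i \in D -> measurable_fun setT (Y i)) /\
  forall B : I -> set R, (forall i, measurable (B i)) ->
    P (\big[setI/setT]_(i in D) (Y i @^-1` B i)) =
    (\prod_(i in D) P (Y i @^-1` B i))%E.

Definition hermitian_pair (n : nat) (A B : 'M[R]_n) : Prop :=
  A^T = A /\ B^T = - B.

Definition entry_rv d (T : measurableType d) (n : nat) (A B : T -> 'M[R]_n)
    (i : 'I_n * 'I_n * bool) : T -> R :=
  fun w => if i.2 then B w i.1.1 i.1.2 else A w i.1.1 i.1.2.

Definition upper_index (n : nat) : {set 'I_n * 'I_n * bool} :=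
  [set i : 'I_n * 'I_n * bool | (i.1.1 <= i.1.2)%N].
End Defs.

(* Main.v *)
Require Import Defs.
From HB Require Import structures.
From mathcomp Require Import all_boot all_order all_algebra.
From mathcomp Require Import all_classical all_reals all_analysis.
From mathcomp Require Import measurable_realfun.
From mathcomp Require Import ring lra.
Import Order.TTheory GRing.Theory Num.Theory.
Import numFieldNormedType.Exports.
Local Open Scope classical_set_scope.
Local Open Scope ring_scope.

(** By duality the norm is a supremum of the linear forms Re <v, X u> over pairs of unit
    vectors of l^p', hence a seminorm bounded by the Frobenius norm.

    Concentration.  After rounding the entries to a grid and truncating them at a multiple of
    sqrt (log n), which moves the norm by O(1) outside an event of probability O(n^-4), the
    entries are independent and bounded by M with M^2 = O(log n), and Maurey's property (tau)
    for convex Lipschitz functions gives E exp (+-(N - E N)) <= exp (O(M^2)) = n^O(1); Markov's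
    inequality then yields deviations of order log n.

    Mean.  Unit vectors are quantized to the levels 2^k n^(-1/p') / 8, and the bilinear form is
    split according to which of the two levels is larger: a level set T of the vector with the
    smaller entry is paired with the part y of the other vector at levels >= m.  Such a pair
    (T, y) costs entropy m |T| + sum_k d_k + n 4^-m, and the subgaussian union bound over all
    pairs, summed over m, gives sqrt p n^(1/p).

    The third bound follows from the other two, as log n <= sqrt (p log n) n^(1/p). *)

(** Convexity makes a dimension-free bound available. Since p' <= 2, the l^p' ball lies in the l^2
    ball, so the norm is Lipschitz for the Frobenius norm, and for convex Lipschitz functions of
    independent bounded entries the exponential moment depends on M and the Lipschitz constant but
    not on the number of coordinates. The grid also turns the law into a finite product measure:
    expectations become finite sums, and inductions over coordinates meet no measurability question.
    The price is that entries are no longer exactly centred; the drift is a negative power of n and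
    adds a constant to the exponents. The factor sqrt p, without a logarithm, comes from the ratio
    between levels: with B = 2^p' one has B^2 / 4 = 4^(p'-1) and p'-1 = 1/(p-1), whence m 4^m <= p
    B^(2m). The union bound is made in mean: a random variable of bounded mean dominates all the
    forms at once, so no tail has to be integrated. *)

(** * Inf-convolution with a quadratic cost, one coordinate at a time *)

Section InfConvolution.
Context {R : realType} {J : finType}.
Implicit Types (f g : (J -> R) -> R) (x y : J -> R) (j : J) (r : seq J).

(** Coordinates are shifted rather than overwritten, so that displacing a coordinate in an
    inf-convolution and sampling it, starting from 0, are the same operation. *)
Definition add_coord x j (t : R) : J -> R := fun i => x i + (if i == j then t else 0).

Definition conv_comb (th : R) x y : J -> R := fun i => (1 - th) * x i + th * y i.

Definition convex_fun f := forall x y (th : R), 0 <= th -> th <= 1 ->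
  f (conv_comb th x y) <= (1 - th) * f x + th * f y.

Definition infconv (c : R) j f : (J -> R) -> R :=
  fun x => inf (range (fun t => f (add_coord x j t) + c * t ^+ 2)).

Definition infconvs (c : R) r f := foldr (infconv c) f r.

Lemma add_coordA x j s t : add_coord (add_coord x j s) j t = add_coord x j (s + t).
Proof. by apply/funext => i; rewrite /add_coord; case: eqP => _; ring. Qed.

Lemma add_coordC x i j s t : add_coord (add_coord x i s) j t = add_coord (add_coord x j t) i s.
Proof. by apply/funext => k; rewrite /add_coord; ring. Qed.

Lemma add_coord_conv_comb th x y j s t :
  add_coord (conv_comb th x y) j ((1 - th) * s + th * t) =
  conv_comb th (add_coord x j s) (add_coord y j t).
Proof. by apply/funext => i; rewrite /add_coord /conv_comb; case: eqP => _; ring. Qed.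

Section nonneg.
Variables (c : R) (f : (J -> R) -> R).
Hypotheses (c0 : 0 <= c) (f0 : forall x, 0 <= f x).

Lemma infconv_le j x t : infconv c j f x <= f (add_coord x j t) + c * t ^+ 2.
Proof.
apply: ge_inf; last by exists t.
by exists 0 => _ [s _ <-]; rewrite addr_ge0// mulr_ge0// sqr_ge0.
Qed.

Lemma le_infconv j x (a : R) : (forall t, a <= f (add_coord x j t) + c * t ^+ 2) ->
  a <= infconv c j f x.
Proof.
move=> h; apply: lb_le_inf; first by exists (f (add_coord x j 0) + c * 0 ^+ 2), 0.
by move=> _ [s _ <-].
Qed.

Lemma infconv_ge0 j x : 0 <= infconv c j f x.
Proof. by apply: le_infconv => t; rewrite addr_ge0// mulr_ge0// sqr_ge0. Qed.

(** Partial minimization of a jointly convex function: the convex combination of two near-minimizers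
    is a competitor at the combined point, and the square is convex in the displacement. *)
Lemma infconv_convex j : convex_fun f -> convex_fun (infconv c j f).
Proof.
move=> cf x y th th0 th1; apply/ler_addgt0Pr => e e0.
have approx z : exists t, f (add_coord z j t) + c * t ^+ 2 < infconv c j f z + e.
  have : has_inf (range (fun t => f (add_coord z j t) + c * t ^+ 2)).
    split; first by exists (f (add_coord z j 0) + c * 0 ^+ 2), 0.
    by exists 0 => _ [s _ <-]; rewrite addr_ge0// mulr_ge0// sqr_ge0.
  by move=> /(inf_adherent e0) [_ [t _ <-] ht]; exists t.
have [s hs] := approx x; have [t ht] := approx y.
have := infconv_le j (conv_comb th x y) ((1 - th) * s + th * t).
rewrite add_coord_conv_comb => /le_trans; apply.
have := cf (add_coord x j s) (add_coord y j t) th th0 th1.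
set A := f _ in hs *; set B := f _ in ht *; set D := f _ => hD.
have : 0 <= c * (th * (1 - th) * (s - t) ^+ 2).
  have ? : 0 <= 1 - th by rewrite subr_ge0.
  by rewrite mulr_ge0 // mulr_ge0 ?sqr_ge0 // mulr_ge0.
have : (1 - th) * (A + c * s ^+ 2) <= (1 - th) * (infconv c j f x + e).
  by rewrite ler_wpM2l ?subr_ge0// ltW.
have : th * (B + c * t ^+ 2) <= th * (infconv c j f y + e).
  by rewrite ler_wpM2l// ltW.
have -> : (1 - th) * (infconv c j f x + e) = (1 - th) * infconv c j f x + e - th * e by ring.
have -> : th * (infconv c j f y + e) = th * infconv c j f y + th * e by ring.
move: hD; rewrite -/D.
have -> : c * (th * (1 - th) * (s - t) ^+ 2) =
  (1 - th) * (c * s ^+ 2) + th * (c * t ^+ 2) - c * ((1 - th) * s + th * t) ^+ 2 by ring.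
rewrite !mulrDr; lra.
Qed.

End nonneg.

Lemma infconvs_ge0 (c : R) f r : 0 <= c -> (forall x, 0 <= f x) ->
  forall x, 0 <= infconvs c r f x.
Proof. by move=> c0 f0; elim: r => [|j r IH] //= x; exact: infconv_ge0. Qed.

Lemma infconvs_convex (c : R) f r : 0 <= c -> (forall x, 0 <= f x) ->
  convex_fun f -> convex_fun (infconvs c r f).
Proof.
by move=> c0 f0 cf; elim: r => [|j r IH] //=; apply: infconv_convex => // x; exact: infconvs_ge0.
Qed.

(** Iterating over distinct coordinates gives at least the joint inf-convolution with cost c |t|^2.
    In the induction a displacement t along [j] is paid for by lowering the bound to a - c t^2. *)
Lemma le_infconvs (c : R) f r x (a : R) : 0 <= c -> uniq r -> (forall x, 0 <= f x) ->
  (forall t : J -> R, (forall i, i \notin r -> t i = 0) ->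
     a <= f (fun i => x i + t i) + c * \sum_(i <- r) t i ^+ 2) ->
  a <= infconvs c r f x.
Proof.
move=> c0 ur f0; elim: r ur x a => [_ x a h|j r IH /= /andP[jr ur] x a h] /=.
  have := h (fun=> 0) (fun _ _ => erefl); rewrite big_nil mulr0 addr0.
  by under eq_fun do rewrite addr0.
apply: le_infconv => t; rewrite -lerBlDr; apply: IH => // s hs.
have sj : s j = 0 by exact: hs.
rewrite lerBlDr.
have := h (fun i => s i + (if i == j then t else 0)).
rewrite big_cons eqxx sj add0r.
under eq_big_seq => i ir.
  have -> : i == j = false by apply: contraNF jr => /eqP <-.
  rewrite addr0; over.
set F1 := f _; set F2 := f _.
have -> : F1 = F2.
  by congr f; apply/funext => i; rewrite /add_coord; case: eqP => _; ring.
rewrite mulrDr -addrA (addrC (c * t ^+ 2)); apply => i.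
rewrite inE negb_or => /andP[/negbTE -> /hs ->]; exact: addr0.
Qed.

End InfConvolution.

(** * Finite product measures and Maurey's property (tau) *)

Section ProductExpectation.
Context {R : realType} {J K : finType}.
Variables (mu : J -> K -> R) (val : K -> R).
Hypotheses (mu0 : forall j k, 0 <= mu j k) (mu1 : forall j, \sum_k mu j k = 1).
Implicit Types (F G : (J -> R) -> R) (x : J -> R) (r : seq J).

(** The iterated form is the one on which property (tau) is tensorized; [expect_sum_ffun] converts
    it into a sum over the product space. *)
Fixpoint expect r F x : R := match r with
  | [::] => F x
  | j :: r' => \sum_k mu j k * expect r' F (add_coord x j (val k))
  end.

Lemma expect_le r F G x : (forall y, F y <= G y) -> expect r F x <= expect r G x.
Proof.
move=> h; elim: r x => [|j r IH] x //=.
by apply: ler_sum => k _; rewrite ler_wpM2l.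
Qed.

Lemma expectD r F G x : expect r (fun y => F y + G y) x = expect r F x + expect r G x.
Proof.
elim: r x => [|j r IH] x //=; rewrite -big_split; apply: eq_bigr => k _.
by rewrite IH mulrDr.
Qed.

Lemma expectZ r F x (a : R) : expect r (fun y => a * F y) x = a * expect r F x.
Proof.
elim: r x => [|j r IH] x //=; rewrite mulr_sumr; apply: eq_bigr => k _.
by rewrite IH mulrCA.
Qed.

Lemma expect_cst r x (a : R) : expect r (fun=> a) x = a.
Proof.
elim: r x => [|j r IH] x //=; under eq_bigr do rewrite IH.
by rewrite -mulr_suml mu1 mul1r.
Qed.

Lemma expect_add_coord r F x j t :
  expect r (fun y => F (add_coord y j t)) x = expect r F (add_coord x j t).
Proof.
elim: r x => [|i r IH] x //=; apply: eq_bigr => k _.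
by rewrite IH add_coordC.
Qed.

Lemma expect_gt0 r F x : (forall y, 0 < F y) -> 0 < expect r F x.
Proof.
move=> h; elim: r x => [|j r IH] x //=.
have P k : 0 <= mu j k * expect r F (add_coord x j (val k)) by rewrite mulr_ge0// ltW.
rewrite lt_neqAle sumr_ge0 // andbT eq_sym; apply/negP => /eqP/psumr_eq0P s0.
have : \sum_k mu j k = 0.
  apply: big1 => k _; have := s0 (fun i _ => P i) k isT.
  by move=> /eqP; rewrite mulf_eq0 (gt_eqF (IH _)) orbF => /eqP.
by rewrite mu1 => /eqP; rewrite oner_eq0.
Qed.

Lemma expR_convex (a b th : R) : 0 <= th -> th <= 1 ->
  expR ((1 - th) * a + th * b) <= (1 - th) * expR a + th * expR b.
Proof.
move=> th0 th1; set m := (1 - th) * a + th * b.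
have key z : expR m * (1 + (z - m)) <= expR z.
  have -> : expR z = expR m * expR (z - m) by rewrite -expRD subrKC.
  by rewrite ler_wpM2l ?expR_ge0// expR_ge1Dx.
have : (1 - th) * (expR m * (1 + (a - m))) <= (1 - th) * expR a.
  by rewrite ler_wpM2l ?subr_ge0.
have : th * (expR m * (1 + (b - m))) <= th * expR b by rewrite ler_wpM2l.
suff : (1 - th) * (expR m * (1 + (a - m))) + th * (expR m * (1 + (b - m))) = expR m by lra.
by rewrite /m; ring.
Qed.

(* Hoelder's inequality, in the form of the convexity of the log-partition function. *)
Lemma ln_expect_convex r F : convex_fun F ->
  convex_fun (fun x => ln (expect r (fun y => expR (F y)) x)).
Proof.
move=> cF x y th th0 th1.
set E := fun x => expect r (fun y => expR (F y)) x.
have E0 z : 0 < E z by apply: expect_gt0 => w; exact: expR_gt0.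
rewrite -/(E x) -/(E y) -/(E (conv_comb th x y)).
rewrite -[leRHS]expRK ler_ln ?posrE ?expR_gt0//.
(* Hoelder's product bound is replaced by a family of bounds, with free parameters a and b, that are
   linear in the two expectations. Linearity lets them pass through the sums term by term; a = ln (E
   x) and b = ln (E y) make the bracket equal to 1. *)
suff : forall a b, expect r (fun y => expR (F y)) (conv_comb th x y) <=
   expR ((1 - th) * a + th * b) *
     ((1 - th) * (expR (- a) * E x) + th * (expR (- b) * E y)).
  move=> /(_ (ln (E x)) (ln (E y))) /le_trans; apply.
  rewrite !expRN !lnK ?posrE// !mulVf ?gt_eqF// !mulr1 subrK mulr1//.
move=> a b; rewrite /E; elim: r x y {E E0} => [|j r IH] x y /=.
  have -> : expR (F (conv_comb th x y)) =
     expR ((1 - th) * a + th * b) * expR (F (conv_comb th x y) - ((1 - th) * a + th * b)).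
    by rewrite -expRD subrKC.
  rewrite ler_wpM2l ?expR_ge0//.
  apply: le_trans (_ : expR ((1 - th) * (F x - a) + th * (F y - b)) <= _).
    by rewrite ler_expR; have := cF x y th th0 th1; lra.
  have expB (z c : R) : expR (- c) * expR z = expR (z - c) by rewrite -expRD addrC.
  rewrite !expB; exact: expR_convex.
rewrite !mulr_sumr -big_split /= mulr_sumr; apply: ler_sum => k _.
set u := expect _ _ _; set v := expect _ _ (add_coord x _ _); set w := expect _ _ (add_coord y _ _).
have -> : forall e1 e2 e3 : R, e1 * ((1 - th) * (e2 * (mu j k * v)) + th * (e3 * (mu j k * w))) =
   mu j k * (e1 * ((1 - th) * (e2 * v) + th * (e3 * w))) by move=> *; ring.
rewrite ler_wpM2l// {}/u {}/v {}/w.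
have -> : add_coord (conv_comb th x y) j (val k) = conv_comb th (add_coord x j (val k)) (add_coord y j (val k)).
  by rewrite -add_coord_conv_comb; congr add_coord; ring.
exact: IH.
Qed.

(* The one-dimensional case of Maurey's property (tau). With [m] the minimum of [h] over the
   support, each point satisfies [e^(G - m) + e^(m - h) <= 2], because moving from the point
   towards the minimizer by the proportion [4u/(1+4u)], [u = h - m], gives
   [G - m <= u / (1 + 2u)]; the product of the two averages is then at most [1]. *)
Lemma tau_property1 (nu G : K -> R) (h : R -> R) (c M : R) (k0 : K) :
  (forall k, 0 <= nu k) -> \sum_k nu k = 1 -> 0 <= c -> c * (32 * M ^+ 2) <= 1 ->
  (forall k, `|val k| <= M) ->
  (forall s t th, 0 <= th -> th <= 1 ->
     h ((1 - th) * s + th * t) <= (1 - th) * h s + th * h t) ->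
  (forall k y, G k <= h y + c * (y - val k) ^+ 2) ->
  (\sum_k nu k * expR (G k)) * (\sum_k nu k * expR (- h (val k))) <= 1.
Proof.
move=> nu0 nu1 c0 cM valM ch hG.
have [k1 _ hk1] := Order.TotalTheory.arg_minP (fun k => h (val k)) (erefl : predT k0).
set m := h (val k1) in hk1.
have pt k : expR (G k - m) + expR (m - h (val k)) <= 2.
  set u := h (val k) - m.
  have u0 : 0 <= u by rewrite subr_ge0 hk1.
  have u4 : 0 < 1 + 4 * u by lra.
  have u2 : 0 < 1 + 2 * u by lra.
  have u1 : 0 < 1 + u by lra.
  (* The terms u - th u + th^2 / 8, where 1/8 bounds c (2M)^2, are smallest at th = 4u; dividing by
     1 + 4u keeps th <= 1 for every u. *)
  pose th := 4 * u / (1 + 4 * u).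
  have th0 : 0 <= th by rewrite divr_ge0; lra.
  have th1 : th <= 1 by rewrite ler_pdivrMr//; lra.
  have Gk : G k - m <= u / (1 + 2 * u).
    have := hG k ((1 - th) * val k + th * val k1).
    have -> : (1 - th) * val k + th * val k1 - val k = th * (val k1 - val k) by ring.
    rewrite exprMn => H1; have := ch (val k) (val k1) _ th0 th1 => H2.
    have D2 : (val k1 - val k) ^+ 2 <= 4 * M ^+ 2.
      have -> : 4 * M ^+ 2 = (2 * M) ^+ 2 by ring.
      rewrite -(ger0_norm (sqr_ge0 (_ - _))) normrX.
      rewrite lerXn2r ?nnegrE//.
        by rewrite mulr_ge0// (le_trans _ (valM k)).
      by rewrite (le_trans (ler_normB _ _))//; have := valM k; have := valM k1; lra.
    have H3 : c * (th ^+ 2 * (val k1 - val k) ^+ 2) <= th ^+ 2 / 8.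
      rewrite mulrCA ler_wpM2l ?sqr_ge0//.
      by have := ler_wpM2l c0 D2; lra.
    have -> : u / (1 + 2 * u) =
       u - th * u + th ^+ 2 / 8 + 4 * u ^+ 3 / ((1 + 4 * u) ^+ 2 * (1 + 2 * u)).
      by rewrite /th; field; rewrite !gt_eqF.
    have : 0 <= 4 * u ^+ 3 / ((1 + 4 * u) ^+ 2 * (1 + 2 * u)).
      by rewrite divr_ge0 ?mulr_ge0 ?exprn_ge0// ltW.
    by move: H1 H2 H3; rewrite -/m /u; lra.
  (* Both exponentials are bounded through e^(-z) >= 1 - z or e^u >= 1 + u; the two fractions over 1
     + u then add up to exactly 2. *)
  have e1 : expR (G k - m) <= (1 + 2 * u) / (1 + u).
    apply: le_trans (_ : expR (u / (1 + 2 * u)) <= _); first by rewrite ler_expR.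
    rewrite -[leLHS]invrK -expRN -[leRHS]invf_div lef_pV2 ?posrE ?expR_gt0 ?divr_gt0//.
    apply: le_trans (expR_ge1Dx _).
    by rewrite le_eqVlt; apply/orP; left; apply/eqP; field; rewrite gt_eqF.
  have e2 : expR (m - h (val k)) <= 1 / (1 + u).
    rewrite -opprB -/u expRN div1r lef_pV2 ?posrE ?expR_gt0//; exact: expR_ge1Dx.
  have := lerD e1 e2; rewrite -mulrDl.
  by have -> : (1 + 2 * u + 1) / (1 + u) = 2 by field; rewrite gt_eqF.
set a := \sum_k nu k * expR (G k - m); set b := \sum_k nu k * expR (m - h (val k)).
have -> : (\sum_k nu k * expR (G k)) * (\sum_k nu k * expR (- h (val k))) = a * b.
  rewrite /a /b.
  under [X in _ = X * _]eq_bigr do rewrite expRD mulrA.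
  under [X in _ = _ * X]eq_bigr do rewrite addrC expRD mulrA.
  by rewrite -!mulr_suml mulrACA -expRD addNr expR0 mulr1.
have a0 : 0 <= a by apply: sumr_ge0 => k _; rewrite mulr_ge0 ?expR_ge0.
have b0 : 0 <= b by apply: sumr_ge0 => k _; rewrite mulr_ge0 ?expR_ge0.
have ab : a + b <= 2.
  have -> : 2 = \sum_k nu k * 2 :> R by rewrite -mulr_suml nu1 mul1r.
  rewrite -big_split /=; apply: ler_sum => k _.
  rewrite -mulrDr; apply: ler_wpM2l; [exact: nu0|exact: pt].
have : 0 <= (a - b) ^+ 2 by exact: sqr_ge0.
have : (a + b) ^+ 2 <= 2 ^+ 2 by rewrite lerXn2r ?nnegrE ?addr_ge0.
rewrite sqrrB sqrrD; lra.
Qed.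

(** Tensorization. For the first coordinate the one-dimensional property is applied to [h], the
    log-partition function of the remaining coordinates, which is convex by [ln_expect_convex]; the
    induction hypothesis bounds the expectation of e^(-f) over those coordinates by e^(-h). *)
Theorem tau_property (c M : R) r f x (k0 : K) : 0 <= c -> c * (32 * M ^+ 2) <= 1 ->
  (forall k, `|val k| <= M) -> (forall y, 0 <= f y) -> convex_fun f ->
  expect r (fun y => expR (infconvs c r f y)) x * expect r (fun y => expR (- f y)) x <= 1.
Proof.
move=> c0 cM valM f0 cf; elim: r x => [|j r IH] x /=.
  by rewrite -expRD subrr expR0.
set Q := infconvs c r f; pose h y := ln (expect r (fun y => expR (Q y)) y).
have E0 F y : 0 < expect r (fun y => expR (F y)) y by apply: expect_gt0 => z; exact: expR_gt0.
have step y : expect r (fun y => expR (- f y)) y <= expR (- h y).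
  by rewrite expRN /h lnK ?posrE// -[leRHS]mulr1 ler_pdivlMl// IH.
pose G k := ln (expect r (fun y => expR (infconv c j Q y)) (add_coord x j (val k))).
(* The infimum along [j] is bounded by one displacement, t - val k, common to all samples of the
   other coordinates; its cost then factors out of the expectation. *)
have Gh k t : G k <= h (add_coord x j t) + c * (t - val k) ^+ 2.
  rewrite -[leRHS]expRK ler_ln ?posrE ?expR_gt0// expRD /h lnK ?posrE//.
  have -> : add_coord x j t = add_coord (add_coord x j (val k)) j (t - val k).
    by rewrite add_coordA addrC subrK.
  rewrite -(expect_add_coord r (fun y => expR (Q y))) mulrC -expectZ; apply: expect_le => y.
  by rewrite -expRD ler_expR addrC infconv_le// => z; exact: infconvs_ge0.
have hc s t th : 0 <= th -> th <= 1 -> h (add_coord x j ((1 - th) * s + th * t)) <=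
    (1 - th) * h (add_coord x j s) + th * h (add_coord x j t).
  move=> th0 th1.
  have := ln_expect_convex r Q (infconvs_convex c f r c0 f0 cf) (add_coord x j s) (add_coord x j t) th th0 th1.
  rewrite -add_coord_conv_comb.
  have -> // : conv_comb th x x = x by apply/funext => i; rewrite /conv_comb; ring.
have H := tau_property1 (mu j) G (fun t => h (add_coord x j t)) c M k0 (mu0 j) (mu1 j) c0 cM valM hc Gh.
apply: le_trans H; apply: ler_pM.
- by apply: sumr_ge0 => k _; rewrite mulr_ge0// ltW.
- by apply: sumr_ge0 => k _; rewrite mulr_ge0// ltW.
- by apply: ler_sum => k _; rewrite /G lnK ?posrE.
- by apply: ler_sum => k _; apply: ler_wpM2l.
Qed.

(** Jensen's inequality, from the tangent line of exp at the mean. *)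
Lemma expect_expR_ge r F x (e : R) : 
  expR (e * expect r F x) <= expect r (fun y => expR (e * F y)) x.
Proof.
set m := e * _.
have -> : expect r (fun y => expR (e * F y)) x =
    expR m * expect r (fun y => expR (e * F y - m)) x.
  by rewrite -expectZ; congr expect; apply/funext => y; rewrite -expRD subrKC.
rewrite -[leLHS]mulr1 ler_wpM2l ?expR_ge0//.
apply: le_trans (_ : expect r (fun y => (1 - m) + e * F y) x <= _).
  by rewrite expectD expect_cst expectZ -/m subrK.
by apply: expect_le => y; have := expR_ge1Dx (e * F y - m); lra.
Qed.

(** Being Lipschitz, [f] loses at most max_S (L S - c S^2) = L^2 / (4c) under inf-convolution.
    Property (tau) thus bounds E e^f times E e^(-f), and Jensen's inequality turns either factor
    into the exponential of the mean, giving both tails. *)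
Lemma convex_lipschitz_concentration (c M L : R) r f x (k0 : K) (e : R) :
  0 < c -> c * (32 * M ^+ 2) <= 1 -> uniq r ->
  (forall k, `|val k| <= M) -> (forall y, 0 <= f y) -> convex_fun f ->
  (forall y z, f y <= f z + L * Num.sqrt (\sum_i (y i - z i) ^+ 2)) ->
  e = 1 \/ e = -1 ->
  expect r (fun y => expR (e * (f y - expect r f x))) x <= expR (L ^+ 2 / (4 * c)).
Proof.
move=> c0 cM ur valM f0 cf lipf eE; set m := expect r f x; set A := L ^+ 2 / (4 * c).
have fQ y : f y - A <= infconvs c r f y.
  apply: le_infconvs => // [|t ht]; first exact: ltW.
  have := lipf y (fun i => y i + t i).
  have -> : \sum_i (y i - (y i + t i)) ^+ 2 = \sum_(i <- r) t i ^+ 2.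
    rewrite [RHS]big_uniq// [RHS]big_mkcond; apply: eq_bigr => i _.
    by case: ifPn => [_|/ht ->]; ring.
  set s := \sum_(i <- r) _; set S := Num.sqrt s => H.
  have s0 : 0 <= s by apply: sumr_ge0 => i _; exact: sqr_ge0.
  have : 0 <= c * (S - L / (2 * c)) ^+ 2 by rewrite mulr_ge0 ?sqr_ge0// ltW.
  have -> : c * (S - L / (2 * c)) ^+ 2 = c * S ^+ 2 - L * S + A.
    by rewrite /A; field; rewrite gt_eqF.
  by rewrite sqr_sqrtr//; lra.
have T := tau_property c M r f x k0 (ltW c0) cM valM f0 cf.
have E0 F y : 0 < expect r (fun y => expR (F y)) y by apply: expect_gt0 => z; exact: expR_gt0.
have T2 : expect r (fun y => expR (f y)) x * expect r (fun y => expR (- f y)) x <= expR A.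
  have : expect r (fun y => expR (f y)) x <=
      expR A * expect r (fun y => expR (infconvs c r f y)) x.
    rewrite -expectZ; apply: expect_le => y; rewrite -expRD ler_expR.
    by have := fQ y; lra.
  move=> /(fun h => ler_pM (ltW (E0 _ _)) (ltW (E0 (fun y => - f y) x)) h (lexx _)) /le_trans; apply.
  by rewrite -mulrA -[leRHS]mulr1 ler_wpM2l ?expR_ge0.
have sep (d : R) : expect r (fun y => expR (d * (f y - m))) x =
    expR (- (d * m)) * expect r (fun y => expR (d * f y)) x.
  by rewrite -expectZ; congr expect; apply/funext => y; rewrite -expRD; congr expR; ring.
have J1 (d : R) := expect_expR_ge r f x d.
rewrite sep; case: eE => ->.
- have -> : (fun y => expR (1 * f y)) = (fun y => expR (f y)) by apply/funext => y; rewrite mul1r.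
  apply: le_trans T2; rewrite mulrC ler_wpM2l ?(ltW (E0 _ _))//.
  have := J1 (-1); rewrite mul1r mulN1r.
  by have -> : (fun y => expR (-1 * f y)) = (fun y => expR (- f y)) by apply/funext => y; rewrite mulN1r.
- have -> : (fun y => expR (-1 * f y)) = (fun y => expR (- f y)) by apply/funext => y; rewrite mulN1r.
  apply: le_trans T2; rewrite mulN1r opprK ler_wpM2r ?(ltW (E0 _ _))//.
  have := J1 1; rewrite mul1r.
  by have -> : (fun y => expR (1 * f y)) = (fun y => expR (f y)) by apply/funext => y; rewrite mul1r.
Qed.

Lemma expect_partial_sum r F (g : {ffun J -> K}) : uniq r ->
  expect r F (fun i => if i \in r then 0 else val (g i)) =
  \sum_(s : {ffun J -> K} | [forall i, (i \notin r) ==> (s i == g i)])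
     (\prod_(j <- r) mu j (s j)) * F (fun i => val (s i)).
Proof.
elim: r g => [g _|j r IH g /= /andP[jr ur]] /=.
  rewrite (big_pred1 g) ?big_nil ?mul1r// => s; apply/forallP/eqP => [h|-> i]; last by rewrite eqxx.
  by apply/ffunP => i; apply/eqP/h.
rewrite (partition_big (fun s : {ffun J -> K} => s j) predT)//=; apply: eq_bigr => k _.
pose g' := [ffun i => if i == j then k else g i].
have -> : add_coord (fun i => if i \in j :: r then 0 else val (g i)) j (val k) =
    fun i => if i \in r then 0 else val (g' i).
  apply/funext => i; rewrite /add_coord inE ffunE.
  by have [->|ij] := eqVneq i j; rewrite /= ?(negbTE jr) ?add0r// addr0.
rewrite IH// mulr_sumr; apply/esym/eq_big => [s|s /andP[_ /eqP sj]]; last first.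
  by rewrite big_cons sj mulrA.
apply/andP/forallP => [[/forallP h /eqP sj] i|h].
  apply/implyP => ir; rewrite ffunE; have [->|ij] := eqVneq i j; first by rewrite sj.
  by apply: (implyP (h i)); rewrite inE negb_or ij.
split; last by have := implyP (h j) jr; rewrite ffunE eqxx.
apply/forallP => i; apply/implyP; rewrite inE negb_or => /andP[ij ir].
by have := implyP (h i) ir; rewrite ffunE (negbTE ij).
Qed.

Lemma expect_sum_ffun F (k0 : K) : expect (enum J) F (fun=> 0) =
  \sum_(s : {ffun J -> K}) (\prod_j mu j (s j)) * F (fun i => val (s i)).
Proof.
have := expect_partial_sum (enum J) F [ffun=> k0] (enum_uniq J).
under eq_fun do rewrite mem_enum inE.
move=> ->; apply: eq_big => [s|s _]; last by rewrite big_enum.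
by apply/forallP => i; rewrite mem_enum.
Qed.

End ProductExpectation.

(** * Duality for the operator norm, and its Frobenius bound *)

Section OperatorNorm.
Context {R : realType}.
Variables (n : nat) (p q : R).
Hypotheses (p2 : 2 <= p) (q1 : 1 <= q) (q2 : q <= 2) (pq : p^-1 + q^-1 = 1).
Implicit Types (A B M : 'M[R]_n) (a b c d x y : 'I_n -> R).

Lemma one_powR (r : R) : 1 `^ r = 1.
Proof. by rewrite powR1. Qed.

Lemma cabs_ge0 (s t : R) : 0 <= cabs s t.
Proof. exact: sqrtr_ge0. Qed.

Lemma sqr_cabs (s t : R) : cabs s t ^+ 2 = s ^+ 2 + t ^+ 2.
Proof. by rewrite sqr_sqrtr// addr_ge0// sqr_ge0. Qed.

Lemma cabsZ (k s t : R) : cabs (k * s) (k * t) = `|k| * cabs s t.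
Proof. by rewrite /cabs !exprMn -mulrDr sqrtrM ?sqr_ge0// sqrtr_sqr. Qed.

Lemma normr_le_cabs (s t : R) : `|s| <= cabs s t /\ `|t| <= cabs s t.
Proof.
by split; rewrite -sqrtr_sqr ler_sqrt ?addr_ge0 ?sqr_ge0// ?lerDl ?lerDr sqr_ge0.
Qed.

Lemma cabs_dot_le (s t u v : R) : s * u + t * v <= cabs s t * cabs u v.
Proof.
rewrite -sqrtrM ?addr_ge0 ?sqr_ge0//; apply: le_trans (ler_norm _) _.
rewrite -sqrtr_sqr ler_sqrt ?mulr_ge0 ?addr_ge0 ?sqr_ge0//.
have : 0 <= (s * v - t * u) ^+ 2 by exact: sqr_ge0.
rewrite !sqrrD !sqrrN; lra.
Qed.

Lemma lpnorm_le1 (r : R) a b : 0 < r -> (lpnorm r a b <= 1) = (\sum_j cabs (a j) (b j) `^ r <= 1).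
Proof.
move=> r0; have S0 : 0 <= \sum_j cabs (a j) (b j) `^ r by apply: sumr_ge0 => j _; exact: powR_ge0.
have ri0 : 0 < r^-1 by rewrite invr_gt0.
apply/idP/idP => h; last first.
  rewrite /lpnorm -[leRHS](one_powR r^-1); apply: ge0_ler_powR => //; last by rewrite nnegrE.
  exact: ltW.
rewrite leNgt; apply/negP => S1; move: h; apply/negP; rewrite -ltNge.
by rewrite -(one_powR r^-1) gt0_ltr_powR// nnegrE.
Qed.

(** The real part of the Hermitian inner product of c + i d and x + i y. *)
Definition cdot c d x y : R := \sum_j (c j * x j + d j * y j).

(** Hoelder's inequality: Young's inequality for |z_j| / s and |v_j|, summed over j, with s the l^p
    norm of z = x + i y. *)
Lemma lpnorm_dual_le c d x y : lpnorm q c d <= 1 -> cdot c d x y <= lpnorm p x y.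
Proof.
have p0 : 0 < p by exact: lt_le_trans p2. have q0 : 0 < q by exact: lt_le_trans q1.
rewrite lpnorm_le1// => cd1; rewrite /lpnorm; set S := \sum_j _ `^ p.
have [S0|] := eqVneq S 0.
  rewrite [X in X <= _]big1 ?powR_ge0// => j _.
  have z0 : cabs (x j) (y j) = 0.
    apply: (@powR_eq0_eq0 _ _ p); apply: (psumr_eq0P _ S0) => // i _; exact: powR_ge0.
  have [] := normr_le_cabs (x j) (y j); rewrite z0 !normr_le0 => /eqP -> /eqP ->.
  by rewrite !mulr0 addr0.
have S0 : 0 <= S by apply: sumr_ge0 => i _; exact: powR_ge0.
move=> SN0; set s := S `^ p^-1.
have s0 : 0 < s by rewrite powR_gt0// lt_neqAle eq_sym SN0.
rewrite -[leRHS]mul1r -ler_pdivrMr// /cdot mulr_suml.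
apply: le_trans (_ : \sum_j (cabs (x j) (y j) `^ p / S / p + cabs (c j) (d j) `^ q / q) <= _).
  apply: ler_sum => j _; apply: le_trans (_ : cabs (x j) (y j) / s * cabs (c j) (d j) <= _).
    rewrite mulrAC ler_pM2r ?invr_gt0//.
    by rewrite (le_trans (cabs_dot_le _ _ _ _))// mulrC.
  have := @conjugate_powR R (cabs (x j) (y j) / s) (cabs (c j) (d j)) p q.
  move=> /(_ (divr_ge0 (cabs_ge0 _ _) (ltW s0)) (cabs_ge0 _ _) p0 q0 pq) /le_trans; apply.
  rewrite powRM ?cabs_ge0 ?invr_ge0 ?(ltW s0)//.
  suff -> : s^-1 `^ p = S^-1 by [].
  rewrite -powR_inv1 ?(ltW s0)// -powRrM mulN1r powRN /s -powRrM mulVf ?gt_eqF//.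
  by rewrite powRr1.
rewrite big_split /= -!mulr_suml -/S divff// mul1r -[leRHS]pq lerD2l -[leRHS]mul1r.
by rewrite ler_pM2r ?invr_gt0.
Qed.

(** The extremal vector is z |z|^(p-2) / s^(p-1), with s the l^p norm of z = x + i y; it lies in the
    l^q ball because (p - 1) q = p. *)
Lemma lpnorm_dual_attained x y :
  exists c d, lpnorm q c d <= 1 /\ cdot c d x y = lpnorm p x y.
Proof.
have p0 : 0 < p by exact: lt_le_trans p2. have q0 : 0 < q by exact: lt_le_trans q1.
have pq1 : (p - 1) * q = p.
  have : p * q * (p^-1 + q^-1) = p * q by rewrite pq mulr1.
  rewrite mulrDr mulrAC divff ?gt_eqF// mulfK ?gt_eqF//; lra.
set S := \sum_j cabs (x j) (y j) `^ p.
have -> : lpnorm p x y = S `^ p^-1 by [].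
have [S0|SN0] := eqVneq S 0.
  exists (fun=> 0), (fun=> 0); split.
    rewrite lpnorm_le1// big1 ?ler01// => j _.
    by rewrite /cabs expr0n addr0 sqrtr0 powR0// gt_eqF.
  by rewrite S0 powR0 ?invr_eq0 ?gt_eqF// /cdot big1// => j _; rewrite !mul0r addr0.
have S0 : 0 < S by rewrite lt_neqAle eq_sym SN0 sumr_ge0// => i _; exact: powR_ge0.
set s := S `^ p^-1.
have s0 : 0 < s by rewrite powR_gt0.
have sp : s `^ p = S by rewrite /s -powRrM mulVf ?gt_eqF// powRr1// ltW.
pose k j := cabs (x j) (y j) `^ (p - 2) / s `^ (p - 1).
have k0 j : 0 <= k j by rewrite divr_ge0 ?powR_ge0.
have zk z : 0 <= z -> z * z `^ (p - 2) = z `^ (p - 1).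
  by move=> z0; rewrite -[RHS]mulr_powRB1//; [congr (_ * _ `^ _); ring|have := p2; lra].
have kz j : k j * cabs (x j) (y j) = cabs (x j) (y j) `^ (p - 1) / s `^ (p - 1).
  by rewrite /k mulrAC [_ * cabs _ _]mulrC zk// cabs_ge0.
exists (fun j => k j * x j), (fun j => k j * y j); split.
  rewrite lpnorm_le1// (eq_bigr (fun j => cabs (x j) (y j) `^ p * S^-1)) => [|j _].
    by rewrite -mulr_suml -/S divff.
  rewrite cabsZ ger0_norm// kz powRM ?invr_ge0 ?powR_ge0//.
  by rewrite -powRrM pq1 -powRN -powRrM mulNr pq1 powRN sp.
rewrite /cdot (eq_bigr (fun j => cabs (x j) (y j) `^ p / s `^ (p - 1))) => [|j _]; last first.
  have -> : k j * x j * x j + k j * y j * y j = k j * (x j ^+ 2 + y j ^+ 2) by ring.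
  by rewrite -sqr_cabs expr2 mulrA kz mulrAC [_ * cabs _ _]mulrC mulr_powRB1 ?cabs_ge0.
rewrite -mulr_suml -/S -{1}sp -(@mulr_powRB1 _ s p) ?(ltW s0)// mulfK//.
by rewrite gt_eqF// powR_gt0.
Qed.

Definition cbilin A B c d a b : R := cdot c d (cmulv_re A B a b) (cmulv_im A B a b).

Lemma cbilinE A B c d a b : cbilin A B c d a b =
  \sum_j \sum_k (A j k * (c j * a k + d j * b k) + B j k * (d j * a k - c j * b k)).
Proof.
rewrite /cbilin /cdot; apply: eq_bigr => j _; rewrite /cmulv_re /cmulv_im.
rewrite !mulr_sumr -big_split /=; apply: eq_bigr => k _; ring.
Qed.

Lemma cabs_le1 a b j : lpnorm q a b <= 1 -> cabs (a j) (b j) <= 1.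
Proof.
have q0 : 0 < q by exact: lt_le_trans q1.
rewrite lpnorm_le1// => h; rewrite leNgt; apply/negP => z1.
have : 1 < cabs (a j) (b j) `^ q.
  by rewrite -[ltLHS](one_powR q) gt0_ltr_powR ?nnegrE ?cabs_ge0.
apply/negP; rewrite -leNgt; apply: le_trans h.
by rewrite (bigD1 j)//= lerDl sumr_ge0// => i _; exact: powR_ge0.
Qed.

(** The entries have modulus at most 1 and q <= 2, so |z|^2 <= |z|^q. Through this inclusion of
    balls the norm is controlled by the Frobenius norm. *)
Lemma sum_sqr_cabs_le1 a b : lpnorm q a b <= 1 -> \sum_j cabs (a j) (b j) ^+ 2 <= 1.
Proof.
have q0 : 0 < q by exact: lt_le_trans q1.
move=> h; move: (h); rewrite lpnorm_le1// => /(le_trans _); apply; apply: ler_sum => j _.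
have [->|z0] := eqVneq (cabs (a j) (b j)) 0; first by rewrite expr0n powR_ge0.
rewrite -powR_mulrn ?cabs_ge0//; apply: ger_powR => //.
by rewrite cabs_le1// lt_neqAle eq_sym z0 cabs_ge0.
Qed.

Lemma cauchy_schwarz_unit (I : finType) (u v : I -> R) :
  \sum_i v i ^+ 2 <= 1 -> \sum_i u i * v i <= Num.sqrt (\sum_i u i ^+ 2).
Proof.
move=> v1; set U := \sum_i u i ^+ 2.
have U0 : 0 <= U by apply: sumr_ge0 => i _; exact: sqr_ge0.
have [U00|UN0] := eqVneq U 0.
  rewrite big1 ?sqrtr_ge0// => i _.
  have /eqP : u i ^+ 2 = 0 by apply: (psumr_eq0P _ U00) => // j _; exact: sqr_ge0.
  by rewrite sqrf_eq0 => /eqP ->; rewrite mul0r.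
set s := Num.sqrt U; have s0 : 0 < s by rewrite sqrtr_gt0 lt_neqAle eq_sym UN0.
have s2 : s ^+ 2 = U by rewrite sqr_sqrtr.
suff : 2 * s * \sum_i u i * v i <= U + s ^+ 2 * \sum_i v i ^+ 2.
  rewrite -s2 => H; rewrite -(ler_pM2l s0).
  have : s ^+ 2 * \sum_i v i ^+ 2 <= s ^+ 2 * 1 by rewrite ler_wpM2l ?sqr_ge0.
  move: H; rewrite -expr2; lra.
rewrite !mulr_sumr -big_split /=; apply: ler_sum => i _.
have : 0 <= (u i - s * v i) ^+ 2 by exact: sqr_ge0.
rewrite sqrrB exprMn; lra.
Qed.

Lemma sum_triple (F : 'I_n * 'I_n * bool -> R) :
  \sum_i F i = \sum_j \sum_k (F (j, k, false) + F (j, k, true)).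
Proof.
rewrite [RHS]pair_big /= [RHS](eq_bigr (fun jk => \sum_(e : bool) F (jk, e))).
  by rewrite pair_big /=; apply: eq_bigr => -[].
by move=> [j k] _; rewrite big_bool addrC.
Qed.

(** Cauchy-Schwarz over the n x n x 2 real entries: the pair of coefficients at (j, k) has squared
    length |v_j|^2 |u_k|^2, where v = c + i d and u = a + i b. *)
Lemma cbilin_le_frobenius A B c d a b : lpnorm q c d <= 1 -> lpnorm q a b <= 1 ->
  cbilin A B c d a b <= Num.sqrt (\sum_j \sum_k (A j k ^+ 2 + B j k ^+ 2)).
Proof.
move=> cd1 ab1; rewrite cbilinE.
pose u (i : 'I_n * 'I_n * bool) := if i.2 then B i.1.1 i.1.2 else A i.1.1 i.1.2.
pose v (i : 'I_n * 'I_n * bool) := if i.2 then d i.1.1 * a i.1.2 - c i.1.1 * b i.1.2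
   else c i.1.1 * a i.1.2 + d i.1.1 * b i.1.2.
have := cauchy_schwarz_unit _ u v; rewrite !sum_triple; apply.
rewrite /v /=.
apply: le_trans (_ : (\sum_j cabs (c j) (d j) ^+ 2) * (\sum_k cabs (a k) (b k) ^+ 2) <= _).
  rewrite mulr_suml; apply: ler_sum => j _; rewrite mulr_sumr; apply: ler_sum => k _.
  by rewrite !sqr_cabs le_eqVlt; apply/orP; left; apply/eqP; ring.
rewrite mulr_ile1 ?sum_sqr_cabs_le1//; apply: sumr_ge0 => j _; exact: sqr_ge0.
Qed.

Lemma lpnorm0 : lpnorm (n := n) q (fun=> 0 : R) (fun=> 0 : R) <= 1 :> R.
Proof.
have q0 : 0 < q by exact: lt_le_trans q1.
rewrite lpnorm_le1// big1 ?ler01// => j _.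
by rewrite /cabs expr0n addr0 sqrtr0 powR0// gt_eqF.
Qed.

Lemma opnorm_le A B (K : R) :
  (forall c d a b, lpnorm q c d <= 1 -> lpnorm q a b <= 1 -> cbilin A B c d a b <= K) ->
  opnorm q p A B <= K.
Proof.
move=> h; apply: ge_sup.
  by exists (lpnorm p (cmulv_re A B (fun=> 0) (fun=> 0)) (cmulv_im A B (fun=> 0) (fun=> 0))),
    (fun=> 0), (fun=> 0); split => //; exact: lpnorm0.
move=> _ [a [b [ab ->]]].
have [c [d [cd <-]]] := lpnorm_dual_attained (cmulv_re A B a b) (cmulv_im A B a b).
exact: h.
Qed.

(** The Frobenius bound supplies the upper bound without which [sup] carries no information. *)
Lemma cbilin_le_opnorm A B c d a b : lpnorm q c d <= 1 -> lpnorm q a b <= 1 ->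
  cbilin A B c d a b <= opnorm q p A B.
Proof.
move=> cd ab; apply: le_trans (lpnorm_dual_le _ _ _ _ cd) _.
apply: ub_le_sup; last by exists a, b.
exists (Num.sqrt (\sum_j \sum_k (A j k ^+ 2 + B j k ^+ 2))) => _ [a' [b' [ab' ->]]].
have [c' [d' [cd' <-]]] := lpnorm_dual_attained (cmulv_re A B a' b') (cmulv_im A B a' b').
exact: cbilin_le_frobenius.
Qed.

Lemma opnorm_ge0 A B : 0 <= opnorm q p A B.
Proof.
have := cbilin_le_opnorm A B _ _ _ _ lpnorm0 lpnorm0.
by rewrite cbilinE big1// => j _; rewrite big1// => k _; ring.
Qed.

Lemma opnorm_le_frobenius A B :
  opnorm q p A B <= Num.sqrt (\sum_j \sum_k (A j k ^+ 2 + B j k ^+ 2)).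
Proof. by apply: opnorm_le => *; exact: cbilin_le_frobenius. Qed.

Lemma cbilinD A B A' B' c d a b : cbilin (A + A') (B + B') c d a b =
  cbilin A B c d a b + cbilin A' B' c d a b.
Proof.
rewrite !cbilinE -big_split; apply: eq_bigr => j _; rewrite -big_split; apply: eq_bigr => k _.
by rewrite !mxE /=; ring.
Qed.

Lemma cbilinZ (t : R) A B c d a b : cbilin (t *: A) (t *: B) c d a b = t * cbilin A B c d a b.
Proof.
rewrite !cbilinE mulr_sumr; apply: eq_bigr => j _; rewrite mulr_sumr; apply: eq_bigr => k _.
by rewrite !mxE; ring.
Qed.

Lemma opnormD A B A' B' : opnorm q p (A + A') (B + B') <= opnorm q p A B + opnorm q p A' B'.
Proof. by apply: opnorm_le => *; rewrite cbilinD lerD// cbilin_le_opnorm. Qed.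

Lemma opnormZ (t : R) A B : 0 <= t -> opnorm q p (t *: A) (t *: B) <= t * opnorm q p A B.
Proof. by move=> t0; apply: opnorm_le => *; rewrite cbilinZ ler_wpM2l// cbilin_le_opnorm. Qed.

Definition bilin M x y : R := \sum_j \sum_k x j * M j k * y k.

Lemma bilinBl M x x' y : bilin M (fun j => x j - x' j) y = bilin M x y - bilin M x' y.
Proof.
rewrite /bilin -sumrB; apply: eq_bigr => j _; rewrite -sumrB; apply: eq_bigr => k _; ring.
Qed.

Lemma bilinBr M x y y' : bilin M x (fun j => y j - y' j) = bilin M x y - bilin M x y'.
Proof.
rewrite /bilin -sumrB; apply: eq_bigr => j _; rewrite -sumrB; apply: eq_bigr => k _; ring.
Qed.

(* Splitting into real and imaginary, then positive and negative parts: 4 real forms,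
   each a combination of 4 forms on nonnegative vectors. *)
Lemma opnorm_le_bilin A B (S : R) :
  (forall x y, (forall j, 0 <= x j) -> (forall j, 0 <= y j) ->
     \sum_j x j `^ q <= 1 -> \sum_j y j `^ q <= 1 ->
     `|bilin A x y| <= S /\ `|bilin B x y| <= S) ->
  opnorm q p A B <= 16 * S.
Proof.
have q0 : 0 < q by exact: lt_le_trans q1.
move=> h; apply: opnorm_le => c d a b cd ab.
rewrite (lpnorm_le1 q c d q0) in cd; rewrite (lpnorm_le1 q a b q0) in ab.
pose ball x := \sum_j `|x j| `^ q <= 1.
have ballS x y : (forall j, `|x j| <= `|y j|) -> ball y -> ball x.
  move=> xy; apply: le_trans; apply: ler_sum => j _.
  by apply: ge0_ler_powR; rewrite ?nnegrE// ltW.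
have H x y : ball x -> ball y -> `|bilin A x y| <= 4 * S /\ `|bilin B x y| <= 4 * S.
  move=> bx by_.
  pose xp j := Num.max (x j) 0; pose xn j := Num.max (- x j) 0.
  pose yp j := Num.max (y j) 0; pose yn j := Num.max (- y j) 0.
  have pos z : 0 <= Num.max z 0 :> R by rewrite le_max lexx orbT.
  have xE : x = fun j => xp j - xn j.
    by apply/funext => j; rewrite /xp /xn; case: (leP (x j) 0) => ?; case: (leP (- x j) 0) => ?; lra.
  have yE : y = fun j => yp j - yn j.
    by apply/funext => j; rewrite /yp /yn; case: (leP (y j) 0) => ?; case: (leP (- y j) 0) => ?; lra.
  have part z (e : R) : `|e| = 1 -> ball z -> \sum_j Num.max (e * z j) 0 `^ q <= 1.
    move=> e1; apply: le_trans; apply: ler_sum => j _.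
    apply: ge0_ler_powR; rewrite ?nnegrE ?(ltW q0)//.
    by rewrite ge_max normr_ge0 -[X in _ <= X]mul1r -e1 -normrM ler_norm.
  have bxp : \sum_j xp j `^ q <= 1.
    by have := part x 1 (normr1 _) bx; under eq_bigr do rewrite mul1r.
  have byp : \sum_j yp j `^ q <= 1.
    by have := part y 1 (normr1 _) by_; under eq_bigr do rewrite mul1r.
  have bxn : \sum_j xn j `^ q <= 1.
    by have := part x (-1) (normrN1 _) bx; under eq_bigr do rewrite mulN1r.
  have byn : \sum_j yn j `^ q <= 1.
    by have := part y (-1) (normrN1 _) by_; under eq_bigr do rewrite mulN1r.
  have [pp1 pp2] := h xp yp (fun=> pos _) (fun=> pos _) bxp byp.
  have [pn1 pn2] := h xp yn (fun=> pos _) (fun=> pos _) bxp byn.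
  have [np1 np2] := h xn yp (fun=> pos _) (fun=> pos _) bxn byp.
  have [nn1 nn2] := h xn yn (fun=> pos _) (fun=> pos _) bxn byn.
  rewrite xE yE !bilinBl !bilinBr.
  have tri (u v w z : R) : `|u| <= S -> `|v| <= S -> `|w| <= S -> `|z| <= S ->
     `|u - v - (w - z)| <= 4 * S.
    by rewrite !ler_norml => /andP[? ?] /andP[? ?] /andP[? ?] /andP[? ?]; apply/andP; split; lra.
  by split; apply: tri.
have part1 x y : (\sum_j cabs (x j) (y j) `^ q <= 1) -> ball x /\ ball y.
  move=> xy; split; apply: le_trans xy; apply: ler_sum => j _;
  have [? ?] := normr_le_cabs (x j) (y j);
  by apply: ge0_ler_powR; rewrite ?nnegrE ?cabs_ge0 ?(ltW q0).
have [bc bd] := part1 _ _ cd; have [ba bb] := part1 _ _ ab.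
have -> : cbilin A B c d a b = bilin A c a + bilin A d b + (bilin B d a - bilin B c b).
  rewrite cbilinE /bilin -sumrB -!big_split /=; apply: eq_bigr => j _.
  by rewrite -sumrB -!big_split /=; apply: eq_bigr => k _; ring.
have [/ler_normlP[_ ?] _] := H _ _ bc ba; have [/ler_normlP[_ ?] _] := H _ _ bd bb.
have [_ /ler_normlP[_ ?]] := H _ _ bd ba; have [_ /ler_normlP[? _]] := H _ _ bc bb.
lra.
Qed.

End OperatorNorm.

(** * Deterministic chaining over dyadic level sets *)

Section Chaining.
Context {R : realType}.
Variable (n : nat).
Implicit Types (M : 'M[R]_n) (x y : 'I_n -> R) (c d : 'I_n -> nat) (T : {set 'I_n}).

(* The vectors used for discretization have entries in {0, 2, 4, 8, ...}; the code 0
   stands for the entry 0, and the code c > 0 for the entry 2^c. *)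
Definition dyadic_vec c : 'I_n -> R := fun j => if c j == 0 then 0 else 2 ^+ c j.

Definition set_vec T : 'I_n -> R := fun j => (j \in T)%:R.

Definition code_cut m c : 'I_n -> nat := fun k => if (m <= c k)%N then c k else 0.

(** The entropy of a pair: m |T| pays for the set and for the level m, the sum of the codes pays for
    the vector, and n / 4^m absorbs the normalization of these weights. *)
Definition code_cost m T c : R :=
  m%:R * #|T|%:R + (\sum_k c k)%:R + n%:R / 4 ^+ m.

Definition sqnorm x : R := \sum_j x j ^+ 2.

Lemma sqnorm_ge0 x : 0 <= sqnorm x.
Proof. by apply: sumr_ge0 => j _; exact: sqr_ge0. Qed.

Lemma code_cost_ge0 m T c : 0 <= code_cost m T c.
Proof. by rewrite !addr_ge0 ?mulr_ge0 ?invr_ge0 ?exprn_ge0. Qed.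

Lemma sqnorm_code_cut m c : sqnorm (dyadic_vec (code_cut m c)) <= sqnorm (dyadic_vec c).
Proof.
apply: ler_sum => k _; rewrite /dyadic_vec /code_cut; case: leqP => // _.
by rewrite eqxx expr0n sqr_ge0.
Qed.

(** The tensor product of the two vectors has Euclidean norm sqrt |T| times that of the dyadic
    vector, so this is the size of a subgaussian form at entropy [code_cost], up to the factor W. *)
Definition chaining_event M (L : nat) (W : R) : Prop := forall m T d, (0 < m)%N ->
  (forall k, d k = 0 \/ (m <= d k <= L)%N) ->
  `|bilin n M (set_vec T) (dyadic_vec d)| <=
    W * Num.sqrt (#|T|%:R * code_cost m T d) * Num.sqrt (sqnorm (dyadic_vec d)).

Definition level_set c m : {set 'I_n} := [set j | c j == m]%SET.

Lemma in_level_set c m j : (j \in level_set c m) = (c j == m).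
Proof. by rewrite inE. Qed.

Lemma sum_pow_code (B : R) c L : (forall j, (c j <= L)%N) ->
  \sum_(1 <= m < L.+1) B ^+ m * #|level_set c m|%:R =
  \sum_j (if c j == 0 then 0 else B ^+ c j).
Proof.
move=> cL.
under eq_bigr => m _.
  rewrite -sum1_card natr_sum mulr_sumr big_mkcond /=.
  under eq_bigr => j _ do rewrite in_level_set mulr1.
  over.
rewrite exchange_big /=; apply: eq_bigr => j _.
have [cj0|cj0] := eqVneq (c j) 0.
  by rewrite big_nat big1// => m /andP[m0 _]; rewrite cj0; case: m m0.
rewrite (bigD1_seq (c j)) ?iota_uniq ?mem_index_iota ?lt0n ?cj0 ?ltnS ?cL//= eqxx.
by rewrite big1 ?addr0// => m; rewrite eq_sym => /negbTE ->.
Qed.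

Section level_sums.
Variables (p B : R) (L : nat).
Hypotheses (p1 : 1 <= p) (B2 : 2 <= B)
  (pB : forall m : nat, m%:R * 4 ^+ m <= p * B ^+ m * B ^+ m).

Let B0 : 0 < B. Proof. exact: lt_le_trans B2. Qed.
Let Bm m : 0 < B ^+ m. Proof. by rewrite exprn_gt0. Qed.
Let p0 : 0 < p. Proof. exact: lt_le_trans p1. Qed.

Lemma sum_geom_le (d : nat) : \sum_(1 <= m < d.+1) B ^+ m <= 2 * B ^+ d.
Proof.
elim: d => [|d IH]; first by rewrite big_nil mulr_ge0.
rewrite big_nat_recr //= exprS; have := Bm d => Bd.
have : 2 * B ^+ d <= B * B ^+ d by rewrite ler_wpM2r// ltW.
lra.
Qed.

Lemma sum_geom_gap_le (d : nat) : \sum_(1 <= m < d.+1) B ^+ m * (p + (d - m)%:R) <= 4 * p * B ^+ d.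
Proof.
elim: d => [|d IH]; first by rewrite big_nil !mulr_ge0 ?(ltW p0).
rewrite big_nat_recr //= subnn addr0.
rewrite (eq_big_nat _ _ (F2 := fun m => B ^+ m * (p + (d - m)%:R) + B ^+ m)); last first.
  by move=> m /andP[_ md]; rewrite subSn// -addn1 natrD; ring.
rewrite big_split /= exprS; have := sum_geom_le d; have := Bm d => Bd.
have : 2 * B ^+ d <= B * B ^+ d by rewrite ler_wpM2r// ltW.
have : 2 * (p * B ^+ d) <= B * (p * B ^+ d) by rewrite ler_wpM2r// mulr_ge0 ?ltW.
have : 1 * B ^+ d <= p * B ^+ d by rewrite ler_wpM2r// ltW.
move: IH; lra.
Qed.

(** Write d = m + (d - m). The first part costs p B^m by [pB], the second at most (d - m) B^m
    because 4 <= B^2; what remains is a geometric sum with linearly growing gaps. *)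
Lemma sum_level_gap (d : nat) : \sum_(1 <= m < d.+1) 4 ^+ m / B ^+ m * d%:R <= 4 * p * B ^+ d.
Proof.
apply: le_trans (sum_geom_gap_le d); apply: ler_sum_nat => m /andP[_ md].
rewrite mulrAC ler_pdivrMr// -[in d%:R](subnKC (_ : m <= d)%N)// natrD mulrDr.
have : 4 ^+ m * (d - m)%:R <= B ^+ m * B ^+ m * (d - m)%:R :> R.
  rewrite ler_wpM2r// -exprMn lerXn2r ?nnegrE ?mulr_ge0 ?(ltW B0)//.
  have : 0 <= (B - 2) * (B + 2) by rewrite mulr_ge0 ?subr_ge0// addr_ge0 ?ltW.
  have -> : (B - 2) * (B + 2) = B * B - 4 by ring.
  by rewrite subr_ge0.
have := pB m; rewrite (mulrC (4 ^+ m) m%:R); lra.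
Qed.

(** For B = 2^q this is the q-th power of the l^q norm of the dyadic vector. *)
Definition code_mass c : R := \sum_j (if c j == 0 then 0 else B ^+ c j).

Lemma code_mass_ge0 c : 0 <= code_mass c.
Proof. by apply: sumr_ge0 => j _; case: ifP => // _; exact: ltW. Qed.

(** The arithmetic-geometric inequality, weighted by sqrt p and (B/2)^m, separates the cardinality
    of the level set from the cost. The cut at m + e leaves a code d_k only at levels m <= d_k,
    where [sum_level_gap] sums its contribution, and the terms n / 4^m become n B^(-m) <= n
    2^(-m). *)
Lemma level_sum_le (c d : 'I_n -> nat) (e : nat) : (forall j, (c j <= L)%N) -> (forall k, (d k <= L)%N) ->
  \sum_(1 <= m < L.+1) 2 ^+ m * Num.sqrt (#|level_set c m|%:R *
      code_cost m (level_set c m) (code_cut (m + e) d)) <=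
  Num.sqrt p * (code_mass c + 2 * code_mass d + n%:R).
Proof.
move=> cL dL; set s := Num.sqrt p.
have s0 : 0 < s by rewrite sqrtr_gt0.
have s2 : s ^+ 2 = p by rewrite sqr_sqrtr// ltW.
pose t m : R := #|level_set c m|%:R.
pose K m := code_cost m (level_set c m) (code_cut (m + e) d).
have amgm m : 2 ^+ m * Num.sqrt (t m * K m) <=
    2^-1 * (s * (B ^+ m * t m) + s^-1 * (4 ^+ m / B ^+ m * K m)).
  have K0 : 0 <= K m by exact: code_cost_ge0.
  have t0 : 0 <= t m by exact: ler0n.
  set u := s * _; set v := s^-1 * _.
  have u0 : 0 <= u by rewrite !mulr_ge0 ?(ltW s0) ?(ltW (Bm m)).
  have v0 : 0 <= v by rewrite mulr_ge0 ?invr_ge0 ?(ltW s0)// mulr_ge0// divr_ge0 ?exprn_ge0// ltW.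
  have uv : u * v = 4 ^+ m * (t m * K m).
    by rewrite /u /v; field; rewrite !gt_eqF.
  have -> : 2 ^+ m * Num.sqrt (t m * K m) = Num.sqrt (u * v).
    rewrite uv [in RHS]sqrtrM ?exprn_ge0//; congr (_ * _).
    have -> : 4 = 2 ^+ 2 :> R by ring.
    by rewrite -exprM mulnC exprM sqrtr_sqr ger0_norm ?exprn_ge0.
  have h : 0 <= 2^-1 * (u + v) by rewrite mulr_ge0 ?addr_ge0.
  rewrite -[leRHS](ger0_norm h) -sqrtr_sqr ler_sqrt ?sqr_ge0//.
  have : 0 <= (u - v) ^+ 2 by exact: sqr_ge0.
  rewrite exprMn sqrrB sqrrD; lra.
apply: le_trans (ler_sum_nat (fun m _ => amgm m)) _.
rewrite -mulr_sumr big_split /= -!mulr_sumr (sum_pow_code B c L cL) -/(code_mass c).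
have S2 : \sum_(1 <= m < L.+1) 4 ^+ m / B ^+ m * K m <= p * code_mass c + 4 * p * code_mass d + n%:R.
  under eq_bigr => m _.
    rewrite /K /code_cost !mulrDr; over.
  rewrite !big_split /=; apply: lerD; first apply: lerD.
  - rewrite /code_mass -(sum_pow_code B c L cL) mulr_sumr.
    apply: ler_sum_nat => m _; rewrite mulrA mulrA ler_wpM2r//.
    rewrite mulrAC ler_pdivrMr// mulrC; exact: pB.
  - under eq_bigr do rewrite natr_sum mulr_sumr.
    rewrite exchange_big /= /code_mass mulr_sumr; apply: ler_sum => k _.
    have [dk|dk] := eqVneq (d k) 0.
      rewrite mulr0 big1// => m _; by rewrite /code_cut dk if_same mulr0.
    apply: le_trans (sum_level_gap (d k)).
    rewrite (big_cat_nat (n := (d k).+1)) ?ltnS//= [X in _ + X]big_nat [X in _ + X]big1 ?addr0.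
      apply: ler_sum_nat => m _; rewrite ler_wpM2l ?divr_ge0 ?exprn_ge0 ?(ltW (Bm m))//.
        exact: ltW.
      by rewrite ler_nat /code_cut; case: (m + e <= d k)%N.
    move=> m /andP[dm _]; rewrite /code_cut leqNgt.
    by rewrite (leq_trans dm) ?leq_addr ?mulr0.
  - apply: le_trans (_ : n%:R * \sum_(1 <= m < L.+1) (2^-1) ^+ m <= _).
      rewrite mulr_sumr; apply: ler_sum_nat => m _.
      have -> : 4 ^+ m / B ^+ m * (n%:R / 4 ^+ m) = n%:R * (B ^+ m)^-1.
        by field; rewrite !gt_eqF ?exprn_gt0.
      rewrite ler_wpM2l// exprVn.
      by rewrite lef_pV2 ?posrE ?exprn_gt0// lerXn2r ?nnegrE ?(ltW B0).
    rewrite -[leRHS]mulr1 ler_wpM2l//.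
    have -> : \sum_(1 <= m < L.+1) 2^-1 ^+ m = 1 - 2^-1 ^+ L :> R.
      elim: L => [|l IH]; first by rewrite big_nil expr0 subrr.
      by rewrite big_nat_recr//= IH exprS; lra.
    by rewrite gerBl exprn_ge0// invr_ge0.
have := code_mass_ge0 c; have := code_mass_ge0 d => d0 c0.
have : s^-1 * \sum_(1 <= m < L.+1) 4 ^+ m / B ^+ m * K m <=
   s * code_mass c + 4 * s * code_mass d + s * n%:R.
  rewrite ler_pdivrMl//; apply: le_trans S2 _; rewrite -s2 !mulrDr !mulrA -!expr2.
  have : 1 * n%:R <= s ^+ 2 * n%:R by rewrite ler_wpM2r// s2.
  lra.
have : 0 <= s * n%:R by rewrite mulr_ge0 ?(ltW s0).
rewrite !mulrDr; lra.
Qed.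

(** With e = 0 for the matrix and e = 1 for its transpose, ties c j = d k are counted exactly
    once. *)
Definition half_form M (e : nat) c d : R :=
  \sum_j \sum_k (if (c j + e <= d k)%N then dyadic_vec c j * M j k * dyadic_vec d k else 0).

Lemma half_form_le M (W : R) (c d : 'I_n -> nat) (e : nat) : 0 <= W -> chaining_event M L W ->
  (forall j, (c j <= L)%N) -> (forall k, (d k <= L)%N) ->
  `|half_form M e c d| <= W * Num.sqrt (sqnorm (dyadic_vec d)) *
     (Num.sqrt p * (code_mass c + 2 * code_mass d + n%:R)).
Proof.
move=> W0 HM cL dL.
have -> : half_form M e c d = \sum_(1 <= m < L.+1) 2 ^+ m *
    bilin n M (set_vec (level_set c m)) (dyadic_vec (code_cut (m + e) d)).
  rewrite /half_form /bilin; under [RHS]eq_bigr do rewrite mulr_sumr.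
  rewrite [RHS]exchange_big /=; apply: eq_bigr => j _.
  have [cj0|cj0] := eqVneq (c j) 0.
    rewrite [LHS]big1 => [|k _]; last by rewrite /dyadic_vec cj0 !mul0r if_same.
    rewrite big_nat big1// => m /andP[m0 _]; rewrite big1 ?mulr0// => k _.
    by rewrite /set_vec in_level_set cj0; case: m m0 => //= m _; rewrite !mul0r.
  rewrite (bigD1_seq (c j)) ?iota_uniq ?mem_index_iota ?lt0n ?cj0 ?ltnS ?cL//=.
  rewrite [X in _ + X]big1 ?addr0 => [|m mc]; last first.
    by rewrite big1 ?mulr0// => k _; rewrite /set_vec in_level_set eq_sym (negbTE mc) !mul0r.
  rewrite mulr_sumr; apply: eq_bigr => k _; rewrite /set_vec in_level_set eqxx mul1r.
  rewrite /dyadic_vec (negbTE cj0) mulrA /code_cut.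
  by case: (c j + e <= d k)%N => //; rewrite eqxx mulr0.
apply: le_trans (ler_norm_sum _ _ _) _.
apply: le_trans (_ : \sum_(1 <= m < L.+1) W * Num.sqrt (sqnorm (dyadic_vec d)) *
   (2 ^+ m * Num.sqrt (#|level_set c m|%:R *
      code_cost m (level_set c m) (code_cut (m + e) d))) <= _).
  apply: ler_sum_nat => m /andP[m0 _]; rewrite normrM (ger0_norm (exprn_ge0 _ _))//.
  have := HM m (level_set c m) (code_cut (m + e) d) m0.
  have /[swap] /[apply] : forall k, code_cut (m + e) d k = 0 \/ (m <= code_cut (m + e) d k <= L)%N.
    move=> k; rewrite /code_cut; case: leqP => [h|_]; [right|by left].
    by rewrite dL andbT (leq_trans _ h)// leq_addr.
  set S1 := Num.sqrt (_ * _) => H.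
  have H2 : Num.sqrt (sqnorm (dyadic_vec (code_cut (m + e) d))) <= Num.sqrt (sqnorm (dyadic_vec d)).
    by rewrite ler_sqrt ?sqnorm_ge0// sqnorm_code_cut.
  have S10 : 0 <= W * S1 by rewrite mulr_ge0// sqrtr_ge0.
  have H3 := ler_wpM2l S10 H2.
  have -> : W * Num.sqrt (sqnorm (dyadic_vec d)) * (2 ^+ m * S1) =
     2 ^+ m * (W * S1 * Num.sqrt (sqnorm (dyadic_vec d))) by ring.
  by rewrite ler_wpM2l ?exprn_ge0// (le_trans H).
rewrite -mulr_sumr ler_wpM2l ?mulr_ge0 ?sqrtr_ge0//; exact: level_sum_le.
Qed.

Lemma bilin_dyadic_le M (W : R) c d : 0 <= W -> chaining_event M L W -> chaining_event M^T L W ->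
  (forall j, (c j <= L)%N) -> (forall k, (d k <= L)%N) ->
  `|bilin n M (dyadic_vec c) (dyadic_vec d)| <=
     W * (Num.sqrt (sqnorm (dyadic_vec c)) + Num.sqrt (sqnorm (dyadic_vec d))) *
     (Num.sqrt p * (2 * code_mass c + 2 * code_mass d + n%:R)).
Proof.
move=> W0 H1 H2 cL dL.
have -> : bilin n M (dyadic_vec c) (dyadic_vec d) = half_form M 0 c d + half_form M^T 1 d c.
  rewrite /half_form [X in _ + X]exchange_big -big_split; apply: eq_bigr => j _.
  rewrite -big_split; apply: eq_bigr => k _ /=; rewrite addn0 addn1 mxE ltnNge.
  by case: leqP => _ /=; rewrite ?addr0 ?add0r//; ring.
apply: le_trans (ler_normD _ _) _.
have h1 := half_form_le M W c d 0 W0 H1 cL dL.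
have h2 := half_form_le M^T W d c 1 W0 H2 dL cL.
apply: le_trans (lerD h1 h2) _.
have c0 := code_mass_ge0 c; have d0 := code_mass_ge0 d.
set sc := Num.sqrt (sqnorm (dyadic_vec c)); set sd := Num.sqrt (sqnorm (dyadic_vec d)).
set X := _ * (2 * _ + _ + _).
have -> : W * (sc + sd) * X = W * sd * X + W * sc * X by ring.
by apply: lerD; apply: ler_wpM2l; rewrite ?mulr_ge0 ?sqrtr_ge0//; apply: ler_wpM2l;
  rewrite ?sqrtr_ge0//; lra.
Qed.

End level_sums.

End Chaining.

(** * Quantization of the unit ball *)

Section Quantization.
Context {R : realType}.
Variables (n : nat) (p q : R).
Hypotheses (n0 : (0 < n)%N) (p2 : 2 <= p) (q1 : 1 <= q) (q2 : q <= 2) (pq : p^-1 + q^-1 = 1).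

Lemma half_le_ln2 : 2^-1 <= ln (2 : R).
Proof.
rewrite -[leLHS]expRK ler_ln ?posrE ?expR_gt0//.
rewrite -[leLHS]invrK -expRN -[leRHS]invrK lef_pV2 ?posrE ?expR_gt0 ?invr_gt0//.
by apply: le_trans (expR_ge1Dx _); lra.
Qed.

Let B : R := 2 `^ q.
Let q0 : 0 < q. Proof. exact: lt_le_trans q1. Qed.
Let n0R : 0 < n%:R :> R. Proof. by rewrite ltr0n. Qed.

Lemma powR2_ge2 : 2 <= B.
Proof. by rewrite -[leLHS]powRr1// ler_powR// ler1n. Qed.

Lemma powR2X (k : nat) : (2 ^+ k) `^ q = B ^+ k.
Proof.
rewrite -(powR_mulrn k (ler0n R 2)) -(powR_mulrn k (powR_ge0 2 q)) /B -!powRrM.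
by rewrite [q * _]mulrC.
Qed.

(** Here B^2 = 4 e^(2 (q-1) ln 2). Raising to the power m and using e^z >= 1 + z gains at least m (q
    - 1), as 2 ln 2 >= 1, and conjugacy gives p (q - 1) >= 1. *)
Lemma powR2_level (m : nat) : m%:R * 4 ^+ m <= p * B ^+ m * B ^+ m.
Proof.
have pq1 : 1 <= p * (q - 1).
  have p0 : 0 < p by exact: lt_le_trans p2.
  have : p * q * (p^-1 + q^-1) = p * q by rewrite pq mulr1.
  rewrite mulrDr mulrAC divff ?gt_eqF// mulfK ?gt_eqF//.
  by have := q1; lra.
have B2E : B * B = 4 * expR (2 * (q - 1) * ln 2).
  rewrite /B -powRD ?pnatr_eq0 ?implybT// /powR pnatr_eq0.
  have -> : 4 = expR (2 * ln 2) :> R by rewrite expRM_natl lnK ?posrE//; ring.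
  by rewrite -expRD; congr expR; ring.
rewrite -mulrA -exprMn B2E exprMn mulrA mulrAC ler_wpM2r ?exprn_ge0//.
rewrite -expRM_natl; apply: le_trans (_ : p * (1 + m%:R * (2 * (q - 1) * ln 2)) <= _); last first.
  by rewrite ler_wpM2l ?expR_ge1Dx// (le_trans _ p2).
have : m%:R * 1 <= m%:R * (p * (q - 1)) by rewrite ler_wpM2l.
have : p * (q - 1) * m%:R * (2 * 2^-1) <= p * (q - 1) * m%:R * (2 * ln 2).
  by rewrite ler_wpM2l ?ler_wpM2l ?half_le_ln2// mulr_ge0// (le_trans ler01).
have := p2; rewrite mulr1; lra.
Qed.

Definition posball (x : 'I_n -> R) : Prop := (forall j, 0 <= x j) /\ \sum_j x j `^ q <= 1.

Let nu : R := n%:R `^ (- q^-1).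
Let delta : R := nu / 8.

Let nu0 : 0 < nu. Proof. exact: powR_gt0. Qed.
Let delta0 : 0 < delta. Proof. exact: divr_gt0. Qed.

Definition code_vec (c : 'I_n -> nat) : 'I_n -> R := fun j => delta * dyadic_vec n c j.

(** Level n + 3 suffices because 2 delta 2^(n+3) >= nu n >= 1. The constant 64 bounds 8^q for q <=
    2, and 8 n^(1/q) is 1 / delta. *)
Definition good_code (c : 'I_n -> nat) : Prop :=
  [/\ forall j, (c j <= n + 3)%N, code_mass n B c <= 64 * n%:R,
      Num.sqrt (sqnorm n (dyadic_vec n c)) <= 8 * n%:R `^ q^-1 & posball (code_vec c)].

Lemma dyadic_level (L : nat) (t : R) : t <= delta * 2 ^+ L.+1 -> exists c : nat, (c <= L)%N /\
  if c == 0 then t <= 2 * delta else (delta * 2 ^+ c <= t) && (t <= 2 * (delta * 2 ^+ c)).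
Proof.
elim: L => [h|L IH h]; first by exists 0; rewrite expr1 mulrC in h.
have [h1|/ltW /IH [c [cL hc]]] := leP (delta * 2 ^+ L.+1) t.
  exists L.+1; split => //=; rewrite h1 /=; move: h; rewrite [2 ^+ L.+2]exprS; lra.
by exists c; split => //; exact: leqW.
Qed.

Lemma posball_sqr (x : 'I_n -> R) : posball x -> sqnorm n x <= 1.
Proof.
move=> [x0 xq]; apply: (le_trans _ xq); apply: ler_sum => j _.
have [->|xj] := eqVneq (x j) 0; first by rewrite expr0n powR_ge0.
rewrite -powR_mulrn//; apply: ger_powR => //.
rewrite lt_neqAle eq_sym xj x0 /= leNgt; apply/negP => x1.
have : 1 < x j `^ q by rewrite -(one_powR q) gt0_ltr_powR ?nnegrE.
apply/negP; rewrite -leNgt; apply: (le_trans _ xq).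
by rewrite (bigD1 j)//= lerDl sumr_ge0// => i _; exact: powR_ge0.
Qed.

(** Rounding down to a level leaves at most half of an entry, or at most 2 delta where the code is
    0. After scaling by 4/3 these are 2/3 of the entry and nu / 3, whose q-th powers sum to at most
    2/3 + 1/3, so the remainder can be quantized again. *)
Lemma quantize x : posball x -> exists c, good_code c /\
  posball (fun j => 4 / 3 * (x j - code_vec c j)).
Proof.
move=> [x0 xq].
have nuq : nu `^ q = n%:R^-1 by rewrite /nu -powRrM mulNr mulVf ?gt_eqF// powR_inv1.
have x1 j : x j <= 1.
  rewrite leNgt; apply/negP => x1.
  have : 1 < x j `^ q by rewrite -(one_powR q) gt0_ltr_powR ?nnegrE.
  apply/negP; rewrite -leNgt; apply: (le_trans _ xq).
  by rewrite (bigD1 j)//= lerDl sumr_ge0// => i _; exact: powR_ge0.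
have nuinv : 1 <= nu * n%:R.
  rewrite /nu -[X in _ * X]powRr1// -powRD ?(gt_eqF n0R) ?implybT//.
  by rewrite -[leLHS](powRr0 (n%:R : R)) ler_powR ?ler1n// addrC subr_ge0 invf_le1.
have [c hc] : exists c : 'I_n -> nat, forall j, (c j <= n + 3)%N /\
    if c j == 0 then x j <= 2 * delta else (delta * 2 ^+ c j <= x j) && (x j <= 2 * (delta * 2 ^+ c j)).
  suff /choice [c hc] : forall j, exists c : nat, (c <= n + 3)%N /\
    if c == 0 then x j <= 2 * delta else (delta * 2 ^+ c <= x j) && (x j <= 2 * (delta * 2 ^+ c)).
    by exists c.
  move=> j; apply: dyadic_level; apply: le_trans (x1 j) _.
  have -> : delta * 2 ^+ (n + 3).+1 = nu * (2 * 2 ^+ n) by rewrite /delta exprS exprD; field.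
  apply: le_trans nuinv _; rewrite ler_wpM2l ?(ltW nu0)//.
  have : n%:R <= 2 ^+ n :> R by rewrite -natrX ler_nat ltnW// ltn_expl.
  by have := exprn_ge0 n (ler0n R 2); lra.
have cvx j : 0 <= code_vec c j <= x j.
  rewrite /code_vec /dyadic_vec; have [_] := hc j; case: ifP => _ h.
    by rewrite mulr0 lexx x0.
  by rewrite mulr_ge0 ?exprn_ge0 ?(ltW delta0)//; case/andP: h.
have pc : posball (code_vec c).
  split=> [j|]; first by have /andP[] := cvx j.
  apply: (le_trans _ xq); apply: ler_sum => j _; have /andP[h1 h2] := cvx j.
  by apply: ge0_ler_powR; rewrite ?nnegrE// ltW.
exists c; split; first split => //.
- by move=> j; have [] := hc j.
- have [_] := pc.
  have -> : \sum_j code_vec c j `^ q = delta `^ q * code_mass n B c.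
    rewrite /code_mass mulr_sumr; apply: eq_bigr => j _; rewrite /code_vec /dyadic_vec.
    case: ifP => _; first by rewrite !mulr0 powR0// gt_eqF.
    by rewrite powRM ?exprn_ge0 ?(ltW delta0)// powR2X.
  have d64 : (64 * n%:R)^-1 <= delta `^ q.
    rewrite /delta powRM ?(ltW nu0) ?invr_ge0// nuq invfM mulrC ler_wpM2l ?invr_ge0//.
    have -> : 64^-1 = 8^-1 `^ 2 :> R by rewrite powR_mulrn ?invr_ge0//; field.
    by apply: ger_powR => //; apply/andP; split; lra.
  have m0 : 0 <= code_mass n B c.
    by apply: sumr_ge0 => j _; case: ifP => // _; rewrite exprn_ge0// powR_ge0.
  move=> h; rewrite -[leRHS]mulr1 -ler_pdivrMl ?mulr_gt0//; apply: le_trans h.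
  by rewrite ler_wpM2r.
- have := posball_sqr _ pc.
  have -> : sqnorm n (code_vec c) = delta ^+ 2 * sqnorm n (dyadic_vec n c).
    by rewrite /sqnorm mulr_sumr; apply: eq_bigr => j _; rewrite exprMn.
  move=> h; have -> : 8 * n%:R `^ q^-1 = delta^-1.
    by rewrite /delta /nu powRN; field; rewrite gt_eqF ?powR_gt0.
  have di0 : 0 <= delta^-1 by rewrite invr_ge0 ltW.
  rewrite -[leRHS](ger0_norm di0) -sqrtr_sqr ler_sqrt ?sqr_ge0//.
  by rewrite exprVn -[leRHS]mulr1 ler_pdivlMl ?exprn_gt0.
- split=> [j|]; first by have /andP[_ h] := cvx j; rewrite mulr_ge0 ?subr_ge0.
  apply: le_trans (_ : \sum_j (2 / 3 * x j `^ q + 1 / 3 * n%:R^-1) <= _).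
    apply: ler_sum => j _.
    have third (a : R) : 0 <= a -> a <= 1 -> a `^ q <= a.
      move=> a0 a1; have [->|an0] := eqVneq a 0; first by rewrite powR0// gt_eqF.
      by apply: ge1r_powR => //; rewrite lt_neqAle eq_sym an0 a0.
    have A1 : (2 / 3 * x j) `^ q <= 2 / 3 * x j `^ q.
      by rewrite powRM// ler_wpM2r ?powR_ge0// third//; lra.
    have A2 : (1 / 3 * nu) `^ q <= 1 / 3 * n%:R^-1.
      by rewrite powRM// ?(ltW nu0)// nuq ler_wpM2r ?invr_ge0// third//; lra.
    have r0 : 0 <= 4 / 3 * (x j - code_vec c j).
      by have /andP[_ h] := cvx j; rewrite mulr_ge0 ?subr_ge0.
    have [h|h] : 4 / 3 * (x j - code_vec c j) <= 2 / 3 * x j \/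
        4 / 3 * (x j - code_vec c j) <= 1 / 3 * nu.
      rewrite /code_vec /dyadic_vec; have [_] := hc j; case: ifP => _ h; [right|left].
        by rewrite mulr0 subr0; move: h; rewrite /delta; lra.
      by case/andP: h => _ h; lra.
    + apply: le_trans (_ : (2 / 3 * x j) `^ q <= _).
        apply: ge0_ler_powR; rewrite ?nnegrE//; first exact: ltW.
        by rewrite mulr_ge0.
      by apply: le_trans A1 _; rewrite lerDl mulr_ge0 ?invr_ge0.
    + apply: le_trans (_ : (1 / 3 * nu) `^ q <= _).
        apply: ge0_ler_powR; rewrite ?nnegrE//; first exact: ltW.
        by rewrite mulr_ge0// ltW.
      by apply: le_trans A2 _; rewrite lerDr mulr_ge0 ?powR_ge0.
  rewrite big_split /= -mulr_sumr sumr_const card_ord.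
  have -> : 1 / 3 * n%:R^-1 *+ n = 1 / 3 :> R by rewrite -mulr_natr; field; rewrite gt_eqF.
  lra.
Qed.

(** Self-improvement replaces an infinite expansion: the supremum S over the ball satisfies S <= Q +
    (3/4) S. The a priori bound by some K makes S finite. *)
Lemma linear_le_quantized (f : ('I_n -> R) -> R) (Q : R) :
  (forall x y, f (fun j => x j - y j) = f x - f y) ->
  (forall (t : R) x, f (fun j => t * x j) = t * f x) ->
  (exists K, forall x, posball x -> `|f x| <= K) ->
  (forall c, good_code c -> `|f (code_vec c)| <= Q) ->
  forall x, posball x -> `|f x| <= 4 * Q.
Proof.
move=> fB fZ [K fK] fQ.
pose E := [set t : R | exists2 x, posball x & t = `|f x|].
have ubE : has_ubound E by exists K => _ [x px ->]; exact: fK.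
have fE x : posball x -> `|f x| <= sup E by move=> px; apply: ub_le_sup => //; exists x.
have step x : posball x -> `|f x| <= Q + 3 / 4 * sup E.
  move=> px; have [c [gc pr]] := quantize x px.
  have xE : f x = f (code_vec c) + 3 / 4 * f (fun j => 4 / 3 * (x j - code_vec c j)).
    rewrite (fZ (4 / 3) (fun j => x j - code_vec c j)) (fB x (code_vec c)).
    by field.
  rewrite xE; apply: le_trans (ler_normD _ _) _; rewrite lerD ?fQ//.
  by rewrite normrM ger0_norm// ler_wpM2l// fE.
move=> x px; have : sup E <= Q + 3 / 4 * sup E.
  by apply: ge_sup; [exists `|f x|, x|move=> _ [y py ->]; exact: step].
by have := fE x px; lra.
Qed.

Lemma bilinZl M (t : R) x y : bilin n M (fun j => t * x j) y = t * bilin n M x y.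
Proof.
rewrite /bilin mulr_sumr; apply: eq_bigr => j _; rewrite mulr_sumr; apply: eq_bigr => k _; ring.
Qed.

Lemma bilinZr M (t : R) x y : bilin n M x (fun j => t * y j) = t * bilin n M x y.
Proof.
rewrite /bilin mulr_sumr; apply: eq_bigr => j _; rewrite mulr_sumr; apply: eq_bigr => k _; ring.
Qed.

Lemma posball_le1 x j : posball x -> `|x j| <= 1.
Proof.
move=> px; have [x0 _] := px; rewrite ger0_norm//.
have := posball_sqr x px; rewrite /sqnorm (bigD1 j)//= => h.
have : x j ^+ 2 <= 1.
  by apply: le_trans h; rewrite lerDl sumr_ge0// => i _; exact: sqr_ge0.
by rewrite expr_le1.
Qed.

Lemma bilin_bounded M x y : posball x -> posball y -> `|bilin n M x y| <= \sum_j \sum_k `|M j k|.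
Proof.
move=> px py; apply: le_trans (ler_norm_sum _ _ _) _; apply: ler_sum => j _.
apply: le_trans (ler_norm_sum _ _ _) _; apply: ler_sum => k _.
rewrite !normrM -[leRHS]mulr1 ler_pM ?mulr_ge0 ?posball_le1//.
by rewrite -[leRHS]mul1r ler_wpM2r ?posball_le1.
Qed.

Theorem bilin_posball_le (M : 'M[R]_n) (W : R) : 0 <= W ->
  chaining_event n M (n + 3) W -> chaining_event n M^T (n + 3) W ->
  forall x y, posball x -> posball y ->
  `|bilin n M x y| <= 1028 * (W * Num.sqrt p * n%:R `^ p^-1).
Proof.
move=> W0 H1 H2.
set K := W * Num.sqrt p * n%:R `^ p^-1.
have K0 : 0 <= K by rewrite !mulr_ge0 ?sqrtr_ge0 ?powR_ge0.
(* The masses give 257 = 2 * 64 + 2 * 64 + 1, the norms give 16 = 8 + 8, and delta^2 = nu^2 / 64;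
   the product is 257 / 4. Quantizing each of the two arguments then costs a factor 4. *)
have main c d : good_code c -> good_code d -> `|bilin n M (code_vec c) (code_vec d)| <= 257 / 4 * K.
  move=> [cL cm cs _] [dL dm ds _].
  have p1 : 1 <= p by rewrite (le_trans _ p2)// ler1n.
  have := bilin_dyadic_le n p B (n + 3) p1 powR2_ge2 powR2_level M W c d W0 H1 H2 cL dL.
  rewrite (bilinZl M delta (dyadic_vec n c) (code_vec d)) (bilinZr M delta _ (dyadic_vec n d)).
  rewrite (normrM delta) (normrM delta) (gtr0_norm delta0).
  set b := `|_|; set sc := Num.sqrt (sqnorm n (dyadic_vec n c)) in cs *.
  set sd := Num.sqrt (sqnorm n (dyadic_vec n d)) in ds *; set u := n%:R `^ q^-1 in cs ds.
  move=> h; have h2 : b <= W * (16 * u) * (Num.sqrt p * (257 * n%:R)).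
    apply: le_trans h _; apply: ler_pM.
    - by rewrite mulr_ge0 ?addr_ge0 ?sqrtr_ge0.
    - rewrite mulr_ge0 ?sqrtr_ge0// !addr_ge0 ?mulr_ge0//.
        by apply: sumr_ge0 => j _; case: ifP => // _; rewrite exprn_ge0// powR_ge0.
      by apply: sumr_ge0 => j _; case: ifP => // _; rewrite exprn_ge0// powR_ge0.
    - by rewrite ler_wpM2l//; lra.
    - by rewrite ler_wpM2l ?sqrtr_ge0//; lra.
  have : delta * (delta * b) <= delta * (delta * (W * (16 * u) * (Num.sqrt p * (257 * n%:R)))).
    by rewrite !ler_wpM2l ?(ltW delta0).
  move=> /le_trans; apply; rewrite le_eqVlt; apply/orP; left; apply/eqP.
  have nun : nu * n%:R = n%:R `^ p^-1.
    rewrite /nu -[X in _ * X]powRr1// -powRD ?(gt_eqF n0R) ?implybT//.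
    by congr (_ `^ _); rewrite -pq; ring.
  have nuu : nu * u = 1.
    by rewrite /nu /u powRN mulVf// gt_eqF// powR_gt0.
  rewrite /K -nun /delta.
  transitivity ((nu * u) * (257 / 4 * (W * Num.sqrt p * (nu * n%:R)))); last by rewrite nuu mul1r.
  by field.
have main2 c : good_code c -> forall x, posball x -> `|bilin n M x (code_vec c)| <= 4 * (257 / 4 * K).
  move=> gc; apply: linear_le_quantized.
  - by move=> x y; rewrite bilinBl.
  - by move=> t x; rewrite bilinZl.
  - exists (\sum_j \sum_k `|M j k|) => x px; apply: bilin_bounded => //.
    by case: gc.
  - by move=> d gd; exact: main.
move=> x y px py.
have -> : 1028 * K = 4 * (4 * (257 / 4 * K)) by field.
move: y py; apply: (linear_le_quantized (fun y => bilin n M x y)).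
- by move=> y z; rewrite bilinBr.
- by move=> t y; rewrite bilinZr.
- by exists (\sum_j \sum_k `|M j k|) => y py; exact: bilin_bounded.
- by move=> d gd; exact: main2.
Qed.

End Quantization.

(** * Subgaussian linear forms and a union bound in mean *)

Section Subgaussian.
Context {R : realType} {J K : finType}.
Variables (mu : J -> K -> R) (val : K -> R).
Hypotheses (mu0 : forall j k, 0 <= mu j k) (mu1 : forall j, \sum_k mu j k = 1).

(** Isolates the linear term, whose mean is nearly 0, from a quadratic exponent. *)
Lemma expR_le_addr_sqr (x : R) : expR x <= x + expR (2 * x ^+ 2).
Proof.
have [xh|xh] := leP x 2^-1.
  have h : expR x <= x + (1 + 2 * x ^+ 2).
    have x1 : 0 < 1 - x by lra.
    apply: le_trans (_ : (1 - x)^-1 <= _).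
      by rewrite -[leLHS]invrK -expRN lef_pV2 ?posrE ?expR_gt0// expR_ge1Dx.
    rewrite -[leLHS]mul1r ler_pdivrMr//.
    have -> : (x + (1 + 2 * x ^+ 2)) * (1 - x) = 1 + x ^+ 2 * (1 - 2 * x) by ring.
    by rewrite lerDl mulr_ge0 ?sqr_ge0//; lra.
  by apply: (le_trans h); rewrite lerD2l expR_ge1Dx.
apply: le_trans (_ : expR (2 * x ^+ 2) <= _); last by rewrite lerDr; lra.
rewrite ler_expR; have : 0 <= x * (2 * x - 1) by rewrite mulr_ge0; lra.
lra.
Qed.

(** For 32 t^2 <= 1, convexity of exp interpolates e^(2 (t v)^2) between 1 and e^(v^2 / 16), with
    weight 32 t^2. For larger t, t v <= 4 t^2 + v^2 / 16, and the factor 2 is at most e^(32 t^2);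
    hence 36 = 4 + 32. The mean enters through |t| eta, split by the arithmetic-geometric
    inequality. *)
Lemma subgaussian_mgf (nu : K -> R) (eta t : R) :
  (forall k, 0 <= nu k) -> \sum_k nu k = 1 ->
  \sum_k nu k * expR (val k ^+ 2 / 16) <= 2 -> `|\sum_k nu k * val k| <= eta ->
  \sum_k nu k * expR (t * val k) <= expR (36 * t ^+ 2 + eta ^+ 2).
Proof.
move=> nu0 nu1 h16 hm.
have [t32|t32] := leP (32 * t ^+ 2) 1.
  set th := 32 * t ^+ 2 in t32.
  have th0 : 0 <= th by rewrite mulr_ge0// sqr_ge0.
  apply: le_trans (_ : t * (\sum_k nu k * val k) + ((1 - th) + th * 2) <= _).
    apply: le_trans (_ : t * (\sum_k nu k * val k) +
       ((1 - th) * (\sum_k nu k) + th * (\sum_k nu k * expR (val k ^+ 2 / 16))) <= _).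
      rewrite !mulr_sumr -!big_split /=; apply: ler_sum => k _.
      have := expR_le_addr_sqr (t * val k).
      have -> : 2 * (t * val k) ^+ 2 = (1 - th) * 0 + th * (val k ^+ 2 / 16).
        by rewrite /th; field.
      have := @expR_convex R 0 (val k ^+ 2 / 16) th th0 t32.
      rewrite expR0; set e := expR (_ / 16); set e2 := expR (_ + _) => h1 h2.
      have : nu k * expR (t * val k) <= nu k * (t * val k + ((1 - th) * 1 + th * e)).
        by rewrite ler_wpM2l//; lra.
      lra.
    by rewrite nu1 mulr1 lerD2l lerD2l ler_wpM2l.
  have : t * (\sum_k nu k * val k) <= `|t| * eta.
    by apply: le_trans (ler_norm _) _; rewrite normrM ler_wpM2l.
  have : 0 <= (`|t| - eta) ^+ 2 by exact: sqr_ge0.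
  have := real_normK (num_real t).
  rewrite sqrrB => -> h1 h2.
  have e0 : 0 <= eta ^+ 2 by exact: sqr_ge0.
  apply: le_trans (expR_ge1Dx _); rewrite /th; have := sqr_ge0 t; lra.
apply: le_trans (_ : expR (4 * t ^+ 2) * 2 <= _).
  apply: le_trans (_ : expR (4 * t ^+ 2) * (\sum_k nu k * expR (val k ^+ 2 / 16)) <= _); last first.
    by rewrite ler_wpM2l ?expR_ge0.
  rewrite mulr_sumr; apply: ler_sum => k _; rewrite mulrCA -expRD ler_wpM2l// ler_expR.
  have : 0 <= (2 * t - val k / 4) ^+ 2 by exact: sqr_ge0.
  have -> : (2 * t - val k / 4) ^+ 2 = 4 * t ^+ 2 + val k ^+ 2 / 16 - t * val k by field.
  lra.
have -> : 36 * t ^+ 2 + eta ^+ 2 = 4 * t ^+ 2 + (32 * t ^+ 2 + eta ^+ 2) by ring.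
rewrite expRD ler_wpM2l ?expR_ge0//; apply: le_trans (expR_ge1Dx _).
by have := sqr_ge0 eta; lra.
Qed.

Lemma expect_expR_linear r (b : J -> R) (x : J -> R) :
  expect mu val r (fun y => expR (\sum_i b i * y i)) x =
  expR (\sum_i b i * x i) * \prod_(j <- r) \sum_k mu j k * expR (b j * val k).
Proof.
elim: r x => [|j r IH] x /=; first by rewrite big_nil mulr1.
rewrite big_cons mulrCA mulr_suml; apply: eq_bigr => k _.
rewrite IH -!mulrA; congr (_ * _); rewrite !mulrA; congr (_ * _); rewrite -expRD; congr expR.
transitivity (\sum_i (b i * x i + b i * (if i == j then val k else 0))).
  by apply: eq_bigr => i _; rewrite -mulrDr.
rewrite big_split /= addrC; congr (_ + _).
by rewrite (bigD1 j)//= eqxx big1 ?addr0// => i /negbTE ->; rewrite mulr0.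
Qed.

Lemma expect_sum (Th : finType) (P : pred Th) (F : Th -> (J -> R) -> R) r x :
  expect mu val r (fun y => \sum_(t | P t) F t y) x = \sum_(t | P t) expect mu val r (F t) x.
Proof.
elim: r x => [|j r IH] x //=.
under eq_bigr do rewrite IH mulr_sumr.
by rewrite exchange_big.
Qed.

Variable eta : R.
Hypotheses (tail : forall j, \sum_k mu j k * expR (val k ^+ 2 / 16) <= 2)
  (mean : forall j, `|\sum_k mu j k * val k| <= eta) (eta1 : #|J|%:R * eta ^+ 2 <= 1).

(** The centring errors of all coordinates add up to |J| eta^2 <= 1, which is the 1 in the
    exponent. *)
Lemma expect_expR_linear_le (b : J -> R) :
  expect mu val (enum J) (fun y => expR (\sum_i b i * y i)) (fun=> 0) <=
  expR (36 * \sum_i b i ^+ 2 + 1).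
Proof.
rewrite expect_expR_linear big1 ?expR0 ?mul1r => [|i _]; last by rewrite mulr0.
rewrite big_enum /=.
apply: le_trans (_ : \prod_j expR (36 * b j ^+ 2 + eta ^+ 2) <= _).
  apply: ler_prod => j _; rewrite subgaussian_mgf// andbT sumr_ge0// => k _.
  by rewrite mulr_ge0 ?expR_ge0.
rewrite -expR_sum ler_expR big_split /= -mulr_sumr lerD2l sumr_const.
by rewrite -mulr_natl.
Qed.

(* [Z] collects the exponential moments of all the linear forms, weighted so that its mean
   is bounded; each single form is then controlled pointwise by [Z]. *)
Theorem weighted_union_bound (Th : finType) (P : pred Th) (a : Th -> J -> R) (cost : Th -> R) :
  (forall t, P t -> 1 <= cost t) -> (forall t, P t -> \sum_i a t i ^+ 2 <= 1) ->
  \sum_(t | P t) expR (- (3 * cost t)) <= 1 ->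
  exists Z : (J -> R) -> R, [/\ forall y, 0 <= Z y,
     expect mu val (enum J) Z (fun=> 0) <= 2 * expR 1 &
     forall y t, P t -> `|\sum_i a t i * y i| <= (39 + Z y) * Num.sqrt (cost t)].
Proof.
move=> cost1 a1 wt1.
pose l t := Num.sqrt (cost t).
(* The form is scaled by the square root of its cost, so its exponential moment costs 36 cost + 1;
   the weight 39 = 36 + 3 leaves the summable e^(-3 cost). *)
pose F (e : R) t (y : J -> R) := expR (- (39 * cost t)) * expR (\sum_i (e * (l t * a t i)) * y i).
pose Z y := \sum_(t | P t) (F 1 t y + F (-1) t y).
have F0 e t y : 0 < F e t y by rewrite mulr_gt0 ?expR_gt0.
have Z0 y : 0 <= Z y by apply: sumr_ge0 => t _; rewrite addr_ge0 ?ltW.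
exists Z; split => //.
  rewrite expect_sum; apply: le_trans (_ : \sum_(t | P t) (2 * expR 1) * expR (- (3 * cost t)) <= _).
    apply: ler_sum => t Pt; have c0 : 0 <= cost t by exact: le_trans (cost1 t Pt).
    have one (e : R) : e ^+ 2 = 1 ->
       expect mu val (enum J) (F e t) (fun=> 0) <= expR 1 * expR (- (3 * cost t)).
      move=> e1; rewrite expectZ.
      apply: le_trans (_ : expR (- (39 * cost t)) * expR (36 * cost t + 1) <= _).
        rewrite ler_wpM2l ?expR_ge0//; apply: le_trans (expect_expR_linear_le _) _.
        rewrite ler_expR lerD2r ler_wpM2l//.
        under eq_bigr do rewrite exprMn e1 mul1r exprMn /l sqr_sqrtr//.
        by rewrite -mulr_sumr -[leRHS]mulr1 ler_wpM2l// a1.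
      by rewrite -!expRD ler_expR; lra.
    rewrite expectD; have := one 1 (expr1n _ _); have := one (-1) (etrans (sqrrN _) (expr1n _ _)).
    lra.
  by rewrite -mulr_sumr -[leRHS]mulr1 ler_wpM2l ?mulr_ge0 ?expR_ge0.
move=> y t Pt; have c1 := cost1 t Pt; have c0 : 0 <= cost t by exact: le_trans c1.
have l1 : 1 <= l t by rewrite -[leLHS]sqrtr1 ler_sqrt.
have l0 : 0 < l t by exact: lt_le_trans l1.
have l2 : l t ^+ 2 = cost t by rewrite sqr_sqrtr.
have FZ e : e = 1 \/ e = -1 -> F e t y <= Z y.
  rewrite /Z (bigD1 t)//= => h.
  have S0 : 0 <= \sum_(i | P i && (i != t)) (F 1 i y + F (-1) i y).
    by apply: sumr_ge0 => i _; rewrite addr_ge0 ?ltW.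
  have := F0 1 t y; have := F0 (-1) t y.
  by case: h => ->; lra.
(* By 1 + z <= e^z, the logarithm of a single term of Z is at most Z; dividing by the scale l >= 1
   gives the bound. *)
have bd e : e = 1 \/ e = -1 -> e * \sum_i a t i * y i <= (39 + Z y) * l t.
  move=> /FZ; rewrite /F -expRD => h.
  have : \sum_i e * (l t * a t i) * y i - 39 * cost t <= Z y.
    rewrite addrC; apply: le_trans h; apply: le_trans (expR_ge1Dx _).
    by rewrite lerDr.
  have -> : \sum_i e * (l t * a t i) * y i = l t * (e * \sum_i a t i * y i).
    by rewrite !mulr_sumr; apply: eq_bigr => i _; ring.
  rewrite -l2 => h2; rewrite -(ler_pM2l l0).
  have := Z0 y => zy.
  have : Z y * 1 <= Z y * (l t * l t).
    by rewrite ler_wpM2l// (le_trans l1)// ler_peMr// ltW.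
  move: h2; rewrite expr2; lra.
rewrite ler_norml; apply/andP; split.
  by have := bd (-1) (or_intror erefl); rewrite mulN1r -/(l t); lra.
by have := bd 1 (or_introl erefl); rewrite mul1r.
Qed.

End Subgaussian.

(** * Summability of the entropy weights *)

Section CodeWeights.
Context {R : realType}.
Variables (n L : nat).

Definition code_index : finType := ('I_L.+1 * {set 'I_n} * {ffun 'I_n -> 'I_L.+1})%type.

(** Nonempty sets have cost at least 1 and leave a spare factor 2^(-m) for the sum over m. *)
Definition code_admissible : pred code_index := fun t =>
  [&& (0 < t.1.1)%N, t.1.2 != finset.set0 &
      [forall k, (t.2 k == 0 :> nat) || (t.1.1 <= t.2 k)%N]].

Definition index_cost (t : code_index) : R :=
  code_cost n t.1.1 t.1.2 (fun k => t.2 k : nat).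

Lemma sum_pow_card (t : R) : \sum_(T : {set 'I_n}) t ^+ #|T| = (1 + t) ^+ n.
Proof.
have := @bigA_distr R 0 1 *%R +%R 'I_n (fun=> t) (fun=> 1).
rewrite prodr_const card_ord addrC => ->; apply: eq_bigr => T _.
by rewrite -big_mkcond /= prodr_const.
Qed.

Lemma sum_geom4 (m l : nat) : (\sum_(i < l.+1) if (i == 0 :> nat) || (m.+1 <= i)%N then 4^-1 ^+ i else 0)
  <= 1 + 2 * 4^-1 ^+ m.+1 :> R.
Proof.
(* The term subtracted for the truncated tail is what makes the bound inductive in l. *)
suff : \sum_(i < l.+1) (if (i == 0 :> nat) || (m.+1 <= i)%N then 4^-1 ^+ i else 0)
   <= 1 + (if (m.+1 <= l)%N then 4 / 3 * 4^-1 ^+ m.+1 - 1 / 3 * 4^-1 ^+ l else 0) :> R.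
  move=> /le_trans; apply; rewrite lerD2l.
  have p1 : 0 <= 4^-1 ^+ m.+1 :> R by rewrite exprn_ge0// invr_ge0.
  have p2 : 0 <= 4^-1 ^+ l :> R by rewrite exprn_ge0// invr_ge0.
  by case: ifP => _; lra.
elim: l => [|l IH]; first by rewrite big_ord_recl big_ord0 /= expr0.
rewrite big_ord_recr /=; move: IH; set S := \sum_(i < _) _ => IH.
have p2 : 0 <= 4^-1 ^+ l :> R by rewrite exprn_ge0// invr_ge0.
move: IH; have [ml|ml] := leqP m.+1 l.
  by rewrite (leqW ml) !exprS; lra.
have [->|ml2] := eqVneq m l.
  by rewrite leqnn !exprS; lra.
by rewrite ltnS leqNgt ltn_neqAle eq_sym ml2 -ltnS ml /=; lra.
Qed.

(** e^(-3) <= 1/8 = (1/2)(1/4). The factors 1/4 give product weights: with u = n / 4^m, the sum over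
    sets is (1 + 4^(-m))^n <= e^u and the sum over codes at most (1 + 2 4^(-m))^n <= e^(2u), both
    cancelled by e^(-3u). The factors 1/2 leave at most 2^(-m), summed over m >= 1. *)
Lemma sum_code_weights : \sum_(t | code_admissible t) expR (- (3 * index_cost t)) <= 1 :> R.
Proof.
have e8 : expR (- 3) <= 8^-1 :> R.
  rewrite expRN lef_pV2 ?posrE ?expR_gt0//.
  have -> : 3 = 6%:R * (1 / 2) :> R by field.
  rewrite expRM_natl; apply: le_trans (_ : (1 + 1 / 2) ^+ 6 <= _); first by rewrite !exprS; lra.
  by rewrite lerXn2r ?nnegrE ?expR_ge0 ?expR_ge1Dx.
have e8n (k : nat) : expR (- (3 * k%:R)) <= 8^-1 ^+ k :> R.
  by rewrite -mulNr mulrC expRM_natl lerXn2r ?nnegrE ?expR_ge0// invr_ge0.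
pose w (m : nat) (T : {set 'I_n}) (d : {ffun 'I_n -> 'I_L.+1}) : R :=
  2^-1 ^+ m * ((4^-1 ^+ m) ^+ #|T| *
   (\prod_k (if (d k == 0 :> nat) || (m <= d k)%N then 4^-1 ^+ d k else 0) *
   expR (- (3 * (n%:R / 4 ^+ m))))).
apply: le_trans (_ : \sum_(t : code_index | (0 < t.1.1)%N) w t.1.1 t.1.2 t.2 <= _).
  rewrite [leLHS]big_mkcond [leRHS]big_mkcond /=; apply: ler_sum => t _.
  have w0 : 0 <= w t.1.1 t.1.2 t.2.
    rewrite !mulr_ge0 ?exprn_ge0 ?invr_ge0 ?exprn_ge0 ?expR_ge0//.
    by apply: prodr_ge0 => k _; case: ifP => // _; rewrite exprn_ge0// invr_ge0.
  case: ifP => [/and3P[m0 T0 /forallP dk]|_]; last by case: ifP.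
  rewrite m0 /w /index_cost /code_cost.
  have -> : - (3 * (t.1.1%:R * #|t.1.2|%:R + (\sum_k t.2 k)%:R + n%:R / 4 ^+ t.1.1)) =
     - (3 * (t.1.1 * #|t.1.2|)%:R) + (- (3 * (\sum_k t.2 k)%:R) + - (3 * (n%:R / 4 ^+ t.1.1))) :> R.
    by rewrite natrM; ring.
  rewrite !expRD [leRHS]mulrA; apply: ler_pM; rewrite ?mulr_ge0 ?expR_ge0//; last first.
    rewrite ler_wpM2r ?expR_ge0//; apply: le_trans (e8n _) _.
    rewrite expr_sum; apply: ler_prod => k _; rewrite (dk k) exprn_ge0 ?invr_ge0//=.
    by rewrite lerXn2r ?nnegrE ?invr_ge0// lef_pV2 ?posrE// ler_nat.
  apply: le_trans (e8n _) _.
  have -> : 8^-1 = 2^-1 * 4^-1 :> R by field.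
  rewrite exprMn !exprM ler_wpM2r ?exprn_ge0 ?invr_ge0//.
  have T1 : (0 < #|t.1.2|)%N by rewrite card_gt0.
  apply: (@le_trans _ _ ((2^-1 ^+ t.1.1) ^+ 1)); last by rewrite expr1.
  by apply: ler_wiXn2l => //; rewrite ?exprn_ge0 ?exprn_ile1 ?invr_ge0// invf_le1// ler1n.
pose G (m : nat) : R := 2^-1 ^+ m * ((1 + 4^-1 ^+ m) ^+ n *
   ((\sum_(i < L.+1) if (i == 0 :> nat) || (m <= i)%N then 4^-1 ^+ i else 0) ^+ n *
   expR (- (3 * (n%:R / 4 ^+ m))))).
have -> : \sum_(t : code_index | (0 < t.1.1)%N) w t.1.1 t.1.2 t.2 = \sum_(m < L.+1 | (0 < m)%N) G m.
  transitivity (\sum_(m < L.+1 | (0 < m)%N) \sum_(T : {set 'I_n})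
      \sum_(d : {ffun 'I_n -> 'I_L.+1}) w m T d).
    rewrite pair_big_dep /= pair_big_dep /=.
    by apply: eq_big => [[[m T] d]|[[m T] d] _] //=; rewrite !andbT.
  apply: eq_bigr => m _; rewrite /w /G -sum_pow_card mulr_suml mulr_sumr; apply: eq_bigr => T _.
  rewrite -!mulr_sumr; congr (_ * (_ * _)); rewrite -mulr_suml; congr (_ * _).
  rewrite -[X in _ = _ ^+ X]card_ord -prodr_const.
  by rewrite bigA_distr_bigA.
apply: le_trans (_ : \sum_(m < L.+1 | (0 < m)%N) 2^-1 ^+ m <= _).
  apply: ler_sum => m m0; rewrite /G -[leRHS]mulr1 ler_wpM2l ?exprn_ge0 ?invr_ge0//.
  set u := n%:R / 4 ^+ m; have b1 : (1 + 4^-1 ^+ m) ^+ n <= expR u :> R.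
    rewrite /u expRM_natl lerXn2r ?nnegrE ?expR_ge0 ?addr_ge0 ?exprn_ge0 ?invr_ge0//.
    by rewrite -exprVn expR_ge1Dx.
  set S := \sum_(i < _) _.
  have S0 : 0 <= S.
    by apply: sumr_ge0 => i _; case: ifP => // _; rewrite exprn_ge0// invr_ge0.
  have b2 : S ^+ n <= expR (2 * u) :> R.
    have -> : 2 * u = n%:R * (2 * 4^-1 ^+ m) by rewrite /u -exprVn; ring.
    rewrite expRM_natl lerXn2r ?nnegrE ?expR_ge0//.
    apply: le_trans (expR_ge1Dx _); rewrite /S; case: (m : nat) m0 => // m' _.
    exact: sum_geom4.
  apply: le_trans (_ : expR u * (expR (2 * u) * expR (- (3 * u))) <= _).
    by rewrite ler_pM ?exprn_ge0 ?addr_ge0 ?mulr_ge0 ?exprn_ge0 ?invr_ge0 ?expR_ge0// ler_wpM2r ?expR_ge0.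
  by rewrite -!expRD -[leRHS]expR0 ler_expR; lra.
rewrite big_mkcond big_ord_recl /= add0r.
have : \sum_(i < L) 2^-1 ^+ (bump 0 i) = 1 - 2^-1 ^+ L :> R.
  elim: L => [|l IH]; first by rewrite big_ord0 expr0 subrr.
  by rewrite big_ord_recr /= IH /bump /= add1n exprS; lra.
rewrite (eq_bigr (fun i : 'I_L => 2^-1 ^+ (bump 0 i) : R)) // => ->.
by rewrite gerBl exprn_ge0// invr_ge0.
Qed.

End CodeWeights.

(** * The chaining event holds in mean *)

Section RandomForms.
Context {R : realType} {n : nat}.
Local Notation I := ('I_n * 'I_n * bool)%type.
Implicit Types (v : I -> R) (M : (I -> R) -> 'M[R]_n).

(** Satisfied with constant 1 when each coordinate fills at most one position. A Hermitian matrix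
    repeats its coordinates and is therefore handled as a combination of triangular pieces. *)
Definition contractive_form M : Prop := forall x y : 'I_n -> R, exists2 a : I -> R,
  \sum_i a i ^+ 2 <= sqnorm n x * sqnorm n y & forall v, bilin n (M v) x y = \sum_i a i * v i.

Lemma bilin_tr (M : 'M[R]_n) x y : bilin n M^T x y = bilin n M y x.
Proof.
rewrite /bilin exchange_big /=; apply: eq_bigr => j _; apply: eq_bigr => k _.
by rewrite mxE; ring.
Qed.

Lemma contractive_form_tr M : contractive_form M -> contractive_form (fun v => (M v)^T).
Proof.
move=> h x y; have [a a1 av] := h y x; exists a; first by rewrite mulrC.
by move=> v; rewrite bilin_tr.
Qed.

Definition select_mx (S : rel 'I_n) (b : bool) v : 'M[R]_n :=
  \matrix_(j, k) (if S j k then v (j, k, b) else 0).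

Lemma select_mx_contractive (S : rel 'I_n) b : contractive_form (select_mx S b).
Proof.
move=> x y; exists (fun i : I => if S i.1.1 i.1.2 && (i.2 == b) then x i.1.1 * y i.1.2 else 0).
  rewrite sum_triple /sqnorm mulr_suml; apply: ler_sum => j _; rewrite mulr_sumr.
  apply: ler_sum => k _; rewrite -exprMn /=.
  by case: (S j k); case: b => /=; rewrite ?expr0n ?addr0 ?add0r// sqr_ge0.
move=> v; rewrite sum_triple; apply: eq_bigr => j _; apply: eq_bigr => k _.
by rewrite mxE /=; case: (S j k); case: b => /=; ring.
Qed.

Lemma chaining_eventD (M M' : 'M[R]_n) L W W' :
  chaining_event n M L W -> chaining_event n M' L W' -> chaining_event n (M + M') L (W + W').
Proof.
move=> h h' m T d m0 dk.
have -> : bilin n (M + M') (set_vec n T) (dyadic_vec n d) =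
  bilin n M (set_vec n T) (dyadic_vec n d) + bilin n M' (set_vec n T) (dyadic_vec n d).
  rewrite /bilin -big_split; apply: eq_bigr => j _; rewrite -big_split; apply: eq_bigr => k _.
  by rewrite mxE /=; ring.
apply: le_trans (ler_normD _ _) _; rewrite !mulrDl; apply: lerD; [exact: h|exact: h'].
Qed.

Lemma chaining_eventN (M : 'M[R]_n) L W : chaining_event n M L W -> chaining_event n (- M) L W.
Proof.
move=> h m T d m0 dk.
have -> : bilin n (- M) (set_vec n T) (dyadic_vec n d) = - bilin n M (set_vec n T) (dyadic_vec n d).
  rewrite /bilin -sumrN; apply: eq_bigr => j _; rewrite -sumrN; apply: eq_bigr => k _.
  by rewrite mxE /=; ring.
by rewrite normrN; exact: h.
Qed.

Lemma sqnorm_set_vec (T : {set 'I_n}) : sqnorm n (set_vec n T) = #|T|%:R :> R.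
Proof.
rewrite /sqnorm -sum1_card natr_sum [RHS]big_mkcond; apply: eq_bigr => j _.
by rewrite /set_vec; case: (j \in T); rewrite ?expr1n ?expr0n.
Qed.

Context {K : finType}.
Variables (mu : I -> K -> R) (val : K -> R) (eta : R).
Hypotheses (mu0 : forall j k, 0 <= mu j k) (mu1 : forall j, \sum_k mu j k = 1)
  (tail : forall j, \sum_k mu j k * expR (val k ^+ 2 / 16) <= 2)
  (mean : forall j, `|\sum_k mu j k * val k| <= eta) (eta1 : #|{: I}|%:R * eta ^+ 2 <= 1).

Local Notation Ex F := (expect mu val (enum {: I}) F (fun=> 0)).

(** The weighted union bound applies to the coefficient vectors normalized by [s t], the Euclidean
    norm of the tensor product; neither n nor L enters the resulting mean. *)
Lemma chaining_event_in_mean L M : contractive_form M ->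
  exists Z : (I -> R) -> R, [/\ forall v, 0 <= Z v, Ex Z <= 2 * expR 1 &
    forall v, chaining_event n (M v) L (39 + Z v)].
Proof.
move=> hM.
pose codes (t : code_index n L) (k : 'I_n) : nat := t.2 k.
have /choice [a0 ha0] : forall t : code_index n L, exists a : I -> R,
    \sum_i a i ^+ 2 <= #|t.1.2|%:R * sqnorm n (dyadic_vec n (codes t)) /\
    forall v, bilin n (M v) (set_vec n t.1.2) (dyadic_vec n (codes t)) = \sum_i a i * v i.
  move=> t; have [a h1 h2] := hM (set_vec n t.1.2) (dyadic_vec n (codes t)).
  by exists a; split => //; rewrite -sqnorm_set_vec.
pose s (t : code_index n L) := Num.sqrt (#|t.1.2|%:R * sqnorm n (dyadic_vec n (codes t))) : R.
pose a (t : code_index n L) i := (s t)^-1 * a0 t i.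
have s2 t : s t ^+ 2 = #|t.1.2|%:R * sqnorm n (dyadic_vec n (codes t)).
  by rewrite sqr_sqrtr// mulr_ge0 ?sqnorm_ge0.
have a1 t : \sum_i a t i ^+ 2 <= 1.
  under eq_bigr do rewrite /a exprMn.
  rewrite -mulr_sumr; have [->|st] := eqVneq (s t) 0; first by rewrite invr0 expr0n mul0r.
  have [h _] := ha0 t; rewrite -s2 in h.
  have s0 : 0 < s t by rewrite lt_neqAle eq_sym st sqrtr_ge0.
  by rewrite exprVn mulrC ler_pdivrMr ?exprn_gt0// mul1r.
have c1 t : code_admissible n L t -> 1 <= index_cost n L t :> R.
  move=> /and3P[m0 T0 _]; rewrite /index_cost /code_cost -addrA.
  have h : 0 <= (\sum_k t.2 k)%:R + n%:R / 4 ^+ t.1.1 :> R.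
    by rewrite addr_ge0 ?divr_ge0 ?exprn_ge0.
  apply: le_trans (_ : t.1.1%:R * #|t.1.2|%:R <= _); last by rewrite lerDl.
  by rewrite -natrM ler1n muln_gt0 m0 card_gt0.
have [Z [Z0 EZ hZ]] := weighted_union_bound mu val mu0 mu1 eta tail mean eta1 _
  (code_admissible n L) a (index_cost n L) c1 (fun t _ => a1 t) (sum_code_weights n L).
exists Z; split => // v m T d m0 dk.
(* Above the top level all codes are 0 and the form vanishes; only m <= L is indexed by
   [code_index]. *)
have [mL|mL] := leqP m L; last first.
  have d0 k : d k = 0.
    by have [//|/andP[h1 h2]] := dk k; move: (leq_trans mL (leq_trans h1 h2)); rewrite ltnn.
  rewrite [X in `|X|]big1 ?normr0 ?mulr_ge0 ?sqrtr_ge0 ?addr_ge0// => j _.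
  by rewrite big1// => k _; rewrite /dyadic_vec d0 mulr0.
have dL k : (d k <= L)%N by have [->//|/andP[_]] := dk k.
pose t : code_index n L := (inord m, T, [ffun k => inord (d k)]).
have tm : t.1.1 = m :> nat by rewrite inordK.
have td : codes t = d by apply/funext => k; rewrite /codes ffunE inordK// ltnS.
have [A1 A2] := ha0 t; move: A2 => /(_ v); rewrite td -[t.1.2]/T => ->.
have W0 : 0 <= 39 + Z v by rewrite addr_ge0.
have cE : index_cost n L t = code_cost n m T d :> R by rewrite /index_cost tm -td.
have sE : s t = Num.sqrt (#|T|%:R) * Num.sqrt (sqnorm n (dyadic_vec n d)).
  by rewrite /s td sqrtrM.
(* The degenerate pairs, with an empty set or a zero vector, have zero coefficients; this includes
   the inadmissible empty set. *)
have [st|st] := eqVneq (s t) 0.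
  rewrite [X in `|X|]big1 ?normr0 ?mulr_ge0 ?sqrtr_ge0// => i _.
  have : \sum_i a0 t i ^+ 2 <= 0 by rewrite (le_trans A1)// -s2 st expr0n.
  move=> h; have /eqP : a0 t i ^+ 2 = 0.
    apply: (psumr_eq0P _ (_ : \sum_i a0 t i ^+ 2 = 0)) => //.
      by move=> j _; exact: sqr_ge0.
    by apply/eqP; rewrite eq_le h sumr_ge0// => j _; exact: sqr_ge0.
  by rewrite sqrf_eq0 => /eqP ->; rewrite mul0r.
have Pt : code_admissible n L t.
  apply/and3P; split; first by rewrite tm.
    by apply: contraNneq st => T0; rewrite sE -[T]/t.1.2 T0 cards0 sqrtr0 mul0r.
  apply/forallP => k; rewrite tm -/(codes t k) td.
  by have [->|/andP[-> _]] := dk k; rewrite ?eqxx ?orbT.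
have s0 : 0 < s t by rewrite lt_neqAle eq_sym st sqrtr_ge0.
have := hZ v t Pt; rewrite cE => h.
have -> : \sum_i a0 t i * v i = s t * \sum_i a t i * v i.
  by rewrite mulr_sumr; apply: eq_bigr => i _; rewrite /a !mulrA divff// mul1r.
rewrite normrM gtr0_norm//; apply: le_trans (ler_wpM2l (ltW s0) h) _.
rewrite sE sqrtrM// le_eqVlt; apply/orP; left; apply/eqP; ring.
Qed.

End RandomForms.

(** * The norm as a convex Lipschitz function of the upper triangle; its mean and concentration on a
    finite product space *)

Section HermitianEnsemble.
Context {R : realType} {n : nat}.
Local Notation I := ('I_n * 'I_n * bool)%type.
Implicit Types (v w : I -> R).

Definition herm_re v : 'M[R]_n :=
  \matrix_(j, k) (if (j <= k)%N then v (j, k, false) else v (k, j, false)).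

Definition herm_im v : 'M[R]_n :=
  \matrix_(j, k) (if (j < k)%N then v (j, k, true) else
                  if (k < j)%N then - v (k, j, true) else 0).

Let le_ord : rel 'I_n := fun j k => (j <= k)%N.
Let lt_ord : rel 'I_n := fun j k => (j < k)%N.

Lemma herm_reE v : herm_re v = select_mx le_ord false v + (select_mx lt_ord false v)^T.
Proof.
by apply/matrixP => j k; rewrite !mxE /le_ord /lt_ord; case: leqP; rewrite ?addr0 ?add0r.
Qed.

Lemma herm_imE v : herm_im v = select_mx lt_ord true v - (select_mx lt_ord true v)^T.
Proof.
apply/matrixP => j k; rewrite !mxE /lt_ord.
by case: (ltngtP j k) => _; rewrite ?subr0 ?sub0r.
Qed.

Lemma herm_re_lin (s t : R) v w :
  herm_re (fun i => s * v i + t * w i) = s *: herm_re v + t *: herm_re w.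
Proof. by apply/matrixP => j k; rewrite !mxE; case: ifP. Qed.

Lemma herm_im_lin (s t : R) v w :
  herm_im (fun i => s * v i + t * w i) = s *: herm_im v + t *: herm_im w.
Proof. by apply/matrixP => j k; rewrite !mxE; case: ifP => _ //; case: ifP => _; ring. Qed.

(** A coordinate fills at most the two positions (j, k) and (k, j); this is the source of the
    Lipschitz constant sqrt 2. *)
Lemma herm_frobenius v : \sum_j \sum_k (herm_re v j k ^+ 2 + herm_im v j k ^+ 2) <=
  2 * \sum_i v i ^+ 2.
Proof.
rewrite sum_triple.
apply: le_trans (_ : \sum_j \sum_k ((v (j, k, false) ^+ 2 + v (j, k, true) ^+ 2) +
   (v (k, j, false) ^+ 2 + v (k, j, true) ^+ 2)) <= _).
  apply: ler_sum => j _; apply: ler_sum => k _; rewrite !mxE.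
  have := sqr_ge0 (v (j, k, false)); have := sqr_ge0 (v (j, k, true)).
  have := sqr_ge0 (v (k, j, false)); have := sqr_ge0 (v (k, j, true)).
  by case: ltngtP => [h|h|/val_inj ->]; rewrite ?sqrrN ?expr0n /=; lra.
under eq_bigr do rewrite big_split /=.
rewrite big_split /= [X in _ + X]exchange_big /=; lra.
Qed.

Variables (p q : R).
Hypotheses (p2 : 2 <= p) (q1 : 1 <= q) (q2 : q <= 2) (pq : p^-1 + q^-1 = 1).

Definition herm_norm v : R := opnorm q p (herm_re v) (herm_im v).

Lemma herm_norm_ge0 v : 0 <= herm_norm v.
Proof. exact: opnorm_ge0. Qed.

Lemma herm_norm_convex : convex_fun herm_norm.
Proof.
move=> x y th th0 th1; rewrite /herm_norm /conv_comb herm_re_lin herm_im_lin.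
apply: le_trans (opnormD n p q p2 q1 q2 pq _ _ _ _) _.
by rewrite lerD// opnormZ// subr_ge0.
Qed.

Lemma herm_norm_lipschitz v w :
  herm_norm v <= herm_norm w + Num.sqrt 2 * Num.sqrt (\sum_i (v i - w i) ^+ 2).
Proof.
have -> : herm_norm v = herm_norm (fun i => 1 * w i + 1 * (v i - w i)).
  by congr herm_norm; apply/funext => i; ring.
rewrite /herm_norm herm_re_lin herm_im_lin !scale1r.
apply: le_trans (opnormD n p q p2 q1 q2 pq _ _ _ _) _; rewrite lerD2l.
apply: le_trans (opnorm_le_frobenius n p q p2 q1 q2 pq _ _) _.
rewrite -sqrtrM// ler_sqrt ?herm_frobenius// mulr_ge0//.
by apply: sumr_ge0 => i _; exact: sqr_ge0.
Qed.

(** Cruder than the Euclidean bound, but additive in the coordinates, so that errors can be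
    integrated one by one. *)
Lemma herm_norm_sub_le v w : `|herm_norm v - herm_norm w| <= 2 * \sum_i `|v i - w i|.
Proof.
have S0 (u : I -> R) : 0 <= \sum_i `|u i| by apply: sumr_ge0.
have h u1 u2 : herm_norm u1 - herm_norm u2 <= 2 * \sum_i `|u1 i - u2 i|.
  rewrite lerBlDl; apply: le_trans (herm_norm_lipschitz u1 u2) _; rewrite lerD2l.
  apply: ler_pM; rewrite ?sqrtr_ge0//.
    by rewrite -[leRHS](ger0_norm (ler0n _ 2)) -sqrtr_sqr ler_sqrt; lra.
  rewrite -[leRHS](ger0_norm (S0 _)) -sqrtr_sqr ler_sqrt ?sqr_ge0//.
  rewrite expr2 mulr_suml; apply: ler_sum => i _.
  rewrite -real_normK ?num_real// expr2 ler_wpM2l//.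
  by rewrite (bigD1 i)//= lerDl sumr_ge0.
rewrite ler_norml; apply/andP; split; last exact: h.
have := h w v; under eq_bigr do rewrite distrC.
move: (herm_norm v) (herm_norm w) (\sum_i _) => a b S; lra.
Qed.

Context {K : finType}.
Variables (mu : I -> K -> R) (val : K -> R) (eta : R).
Hypotheses (mu0 : forall j k, 0 <= mu j k) (mu1 : forall j, \sum_k mu j k = 1)
  (tail : forall j, \sum_k mu j k * expR (val k ^+ 2 / 16) <= 2)
  (mean : forall j, `|\sum_k mu j k * val k| <= eta) (eta1 : #|{: I}|%:R * eta ^+ 2 <= 1)
  (n0 : (0 < n)%N).

Local Notation Ex F := (expect mu val (enum {: I}) F (fun=> 0)).

(** 16 comes from splitting complex forms into nonnegative real ones, 1028 from quantization, and 6
    (39 + 2e) bounds the mean of the sum of the six chaining factors. *)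
Definition mean_const : R := 16 * 1028 * (6 * (39 + 2 * expR 1)).

(** The real and imaginary parts and their transposes are each a sum or difference of two among
    three triangular matrices and their transposes. A single [W], with 234 = 6 * 39, dominates every
    factor needed. *)
Theorem expect_herm_norm_le : Ex herm_norm <= mean_const * (Num.sqrt p * n%:R `^ p^-1).
Proof.
have ev M := @chaining_event_in_mean R n K mu val eta mu0 mu1 tail mean eta1 (n + 3) M.
have c1 := select_mx_contractive (R := R) le_ord false.
have c2 := select_mx_contractive (R := R) lt_ord false.
have c3 := select_mx_contractive (R := R) lt_ord true.
have [Z1 [P1 E1 H1]] := ev _ c1.
have [Z2 [P2 E2 H2]] := ev _ (contractive_form_tr _ c1).
have [Z3 [P3 E3 H3]] := ev _ c2.
have [Z4 [P4 E4 H4]] := ev _ (contractive_form_tr _ c2).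
have [Z5 [P5 E5 H5]] := ev _ c3.
have [Z6 [P6 E6 H6]] := ev _ (contractive_form_tr _ c3).
pose W v := 234 + (Z1 v + (Z2 v + (Z3 v + (Z4 v + (Z5 v + Z6 v))))).
have W0 v : 0 <= W v by rewrite !addr_ge0.
have mono (M : 'M[R]_n) (w w' : R) : w <= w' -> chaining_event n M (n + 3) w -> chaining_event n M (n + 3) w'.
  move=> ww h m T d m0 dk; apply: le_trans (h m T d m0 dk) _.
  by rewrite !ler_wpM2r ?sqrtr_ge0.
set s := Num.sqrt p * _.
have s0 : 0 <= s by rewrite mulr_ge0 ?sqrtr_ge0 ?powR_ge0.
have NW v : herm_norm v <= (16 * 1028 * s) * W v.
  have := P1 v; have := P2 v; have := P3 v; have := P4 v; have := P5 v; have := P6 v.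
  move=> ? ? ? ? ? ?.
  have A1 : chaining_event n (herm_re v) (n + 3) (W v).
    apply: mono (_ : (39 + Z1 v) + (39 + Z4 v) <= _) _; first by rewrite /W; lra.
    by rewrite herm_reE; apply: chaining_eventD.
  have A2 : chaining_event n (herm_re v)^T (n + 3) (W v).
    apply: mono (_ : (39 + Z2 v) + (39 + Z3 v) <= _) _; first by rewrite /W; lra.
    by rewrite herm_reE linearD /= trmxK; apply: chaining_eventD.
  have B1 : chaining_event n (herm_im v) (n + 3) (W v).
    apply: mono (_ : (39 + Z5 v) + (39 + Z6 v) <= _) _; first by rewrite /W; lra.
    by rewrite herm_imE; apply: chaining_eventD => //; apply: chaining_eventN.
  have B2 : chaining_event n (herm_im v)^T (n + 3) (W v).
    apply: mono (_ : (39 + Z6 v) + (39 + Z5 v) <= _) _; first by rewrite /W; lra.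
    by rewrite herm_imE linearB /= trmxK; apply: chaining_eventD => //; apply: chaining_eventN.
  have hA := bilin_posball_le n p q n0 p2 q1 q2 pq _ _ (W0 v) A1 A2.
  have hB := bilin_posball_le n p q n0 p2 q1 q2 pq _ _ (W0 v) B1 B2.
  have -> : 16 * 1028 * s * W v = 16 * (1028 * (W v * Num.sqrt p * n%:R `^ p^-1)).
    by rewrite /s; ring.
  apply: opnorm_le_bilin => // x y x0 y0 x1 y1.
  by split; [apply: hA|apply: hB].
apply: le_trans (expect_le _ _ mu0 _ _ _ _ NW) _.
rewrite expectZ.
have -> : mean_const * s = 16 * 1028 * s * (6 * (39 + 2 * expR 1)).
  by rewrite /mean_const; move: (expR 1) => e; ring.
apply: ler_wpM2l.
  apply: mulr_ge0; [apply: mulr_ge0; exact: ler0n|exact: s0].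
rewrite /W (expectD mu val _ (fun=> 234)) (expect_cst mu val mu1) (expectD mu val _ Z1).
rewrite (expectD mu val _ Z2) (expectD mu val _ Z3) (expectD mu val _ Z4) (expectD mu val _ Z5).
move: E1 E2 E3 E4 E5 E6; move: (expR 1) (Ex Z1) (Ex Z2) (Ex Z3) (Ex Z4) (Ex Z5) (Ex Z6).
move=> *; lra.
Qed.

Theorem herm_norm_concentration (c M : R) (k0 : K) (e : R) :
  0 < c -> c * (32 * M ^+ 2) <= 1 -> (forall k, `|val k| <= M) -> e = 1 \/ e = -1 ->
  Ex (fun v => expR (e * (herm_norm v - Ex herm_norm))) <= expR (1 / (2 * c)).
Proof.
move=> c0 cM vM eE.
have := convex_lipschitz_concentration mu val mu0 mu1 c M (Num.sqrt 2) (enum {: I}) herm_norm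
  (fun=> 0) k0 e c0 cM (enum_uniq _) vM herm_norm_ge0 herm_norm_convex herm_norm_lipschitz eE.
rewrite sqr_sqrtr//; have -> // : 2 / (4 * c) = 1 / (2 * c) by field; rewrite gt_eqF.
Qed.

End HermitianEnsemble.

(** * From the subgaussian norm to an exponential moment of the square *)

Section Psi2Moment.
Context {R : realType}.

Lemma expR1_le4 : expR 1 <= 4 :> R.
Proof.
have h : expR 2^-1 <= 2 :> R.
  rewrite -[leLHS]invrK -expRN -[leRHS]invrK lef_pV2 ?posrE ?expR_gt0 ?invr_gt0//.
  by apply: le_trans (expR_ge1Dx _); lra.
have -> : expR 1 = expR (2%:R * 2^-1) :> R by congr expR; field.
have -> : 4 = 2 ^+ 2 :> R by ring.
rewrite expRM_natl.
by rewrite lerXn2r ?nnegrE ?expR_ge0.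
Qed.

(** k^k / k! is a single term of the series of e^k, and e <= 4. *)
Lemma natX_le_fact (k : nat) : k%:R ^+ k <= 4 ^+ k * k`!%:R :> R.
Proof.
case: k => [|k]; first by rewrite !expr0 fact0 mul1r.
rewrite -ler_pdivrMr ?ltr0n ?fact_gt0//.
have /le_trans : k.+1%:R ^+ k.+1 / k.+1`!%:R <= expR (k.+1%:R : R).
  by apply: le_trans (expR_ge1Dxn k (ler0n R k.+1)); rewrite lerDr.
apply; rewrite -[k.+1%:R]mulr1 expRM_natl lerXn2r ?nnegrE ?expR_ge0//; exact: expR1_le4.
Qed.

Context d (T : measurableType d) (P : probability T R).

Lemma psi2norm_moment (Y : T -> R) (k : nat) : (psi2norm P Y <= 1)%E -> (0 < k)%N ->
  (\int[P]_w (`|Y w| ^+ (2 * k))%:E <= ((2 * k)%:R ^+ k)%:E)%E.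
Proof.
move=> hY k0; set q : R := (2 * k)%:R.
have q0 : 0 < q by rewrite ltr0n muln_gt0.
have q1 : 1 <= q by rewrite ler1n muln_gt0.
have -> : (\int[P]_w (`|Y w| ^+ (2 * k))%:E = \int[P]_w (`|Y w| `^ q)%:E)%E.
  by apply: eq_integral => w _; rewrite powR_mulrn.
set m := (\int[P]_w _)%E.
have m0 : (0 <= m)%E by apply: integral_ge0 => w _; rewrite lee_fin powR_ge0.
have h : ((q `^ (- 2^-1))%:E * m `^ q^-1 <= 1)%E.
  by apply: le_trans hY; apply: ereal_sup_ubound; exists q.
have a0 : (0 <= (q `^ (- 2^-1))%:E * m `^ q^-1)%E.
  by rewrite mule_ge0 ?lee_fin ?powR_ge0 ?poweR_ge0.
have := @gt0_ler_poweR R q (ltW q0) _ _ _ _ h.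
rewrite !in_itv /= !leey !andbT a0 lee_fin ler01 => /(_ isT isT) /=.
rewrite one_powR poweRM ?lee_fin ?powR_ge0 ?poweR_ge0// -poweRrM mulVf ?gt_eqF// poweRe1//.
rewrite poweR_EFin -powRrM.
have -> : - 2^-1 * q = - k%:R by rewrite /q natrM; field.
rewrite powRN powR_mulrn ?(ltW q0)// => h2.
have qk0 : 0 < q ^+ k by rewrite exprn_gt0.
have := lee_wpmul2l (_ : 0%:E <= (q ^+ k)%:E)%E h2.
rewrite lee_fin muleA -EFinM divff ?gt_eqF// mul1e mule1; apply.
exact: ltW.
Qed.

Lemma EFin_expR_series (x : R) : 0 <= x -> (expR x)%:E = (\sum_(k <oo) (x ^+ k / k`!%:R)%:E)%E.
Proof.
move=> x0; rewrite /expR -EFin_lim; last exact: is_cvg_series_exp_coeff.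
congr (limn _); apply/funext => N /=.
by rewrite /series /= sumEFin; congr (_%:E); apply: eq_bigr.
Qed.

(** Integrating the exponential series term by term, the k-th term is at most (2k)^k / (16^k k!) <=
    (2 * 4 / 16)^k = 2^(-k); the scale 16 is chosen so that these sum to at most 2. *)
Theorem psi2norm_exp_moment (Y : T -> R) : measurable_fun setT Y -> (psi2norm P Y <= 1)%E ->
  (\int[P]_w (expR (Y w ^+ 2 / 16))%:E <= 2%:E)%E.
Proof.
move=> mY hY.
have x0 w : 0 <= Y w ^+ 2 / 16 by rewrite divr_ge0 ?sqr_ge0.
have t0 w k : 0 <= (Y w ^+ 2 / 16) ^+ k / k`!%:R by rewrite divr_ge0 ?exprn_ge0.
under eq_integral => w _ do rewrite EFin_expR_series//.
rewrite integral_nneseries//; last 2 first.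
- move=> k; apply/measurable_EFinP; apply: measurable_funM => //.
  by apply: measurable_funX; apply: measurable_funM => //; exact: measurable_funX.
- by move=> k w _; rewrite lee_fin.
have term k : (\int[P]_w ((Y w ^+ 2 / 16) ^+ k / k`!%:R)%:E <= (2^-1 ^+ k)%:E)%E.
  case: k => [|k].
    under eq_integral do rewrite expr0 fact0 divr1.
    by rewrite integral_cst// expr0 mul1e probability_le1.
  have -> : (\int[P]_w ((Y w ^+ 2 / 16) ^+ k.+1 / k.+1`!%:R)%:E =
     \int[P]_w (((16 ^+ k.+1 * k.+1`!%:R)^-1)%:E * (`|Y w| ^+ (2 * k.+1))%:E))%E.
    apply: eq_integral => w _; rewrite -EFinM; congr (_%:E).
    by rewrite exprM real_normK ?num_real// expr_div_n invfM; ring.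
  have c0 : 0 <= (16 ^+ k.+1 * k.+1`!%:R)^-1 :> R by rewrite invr_ge0 mulr_ge0 ?exprn_ge0.
  rewrite ge0_integralZl_EFin//.
  - have c0' : (0%:E <= ((16 ^+ k.+1 * k.+1`!%:R : R)^-1)%:E)%E. by rewrite lee_fin.
    apply: le_trans (lee_wpmul2l c0' (psi2norm_moment Y k.+1 hY isT)) _.
    rewrite -EFinM lee_fin natrM exprMn.
    have f0 : 0 < k.+1`!%:R :> R by rewrite ltr0n fact_gt0.
    rewrite mulrC ler_pdivrMr ?mulr_gt0 ?exprn_gt0//.
    have -> : 2^-1 ^+ k.+1 * (16 ^+ k.+1 * k.+1`!%:R) = 2 ^+ k.+1 * (4 ^+ k.+1 * k.+1`!%:R) :> R.
      rewrite !mulrA -!exprMn; congr (_ ^+ _ * _); by field.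
    by rewrite ler_wpM2l ?exprn_ge0// natX_le_fact.
  - by apply/measurable_EFinP; apply: measurable_funX; exact: measurableT_comp.
apply: lime_le.
  by apply: is_cvg_nneseries => k _ _; apply: integral_ge0 => w _; rewrite lee_fin.
apply: nearW => N; apply: (@le_trans _ _ (\sum_(0 <= k < N) (2^-1 ^+ k)%:E)%E).
  by apply: lee_sum => k _; exact: term.
rewrite sumEFin lee_fin.
have -> : \sum_(0 <= k < N) 2^-1 ^+ k = 2 - 2 * 2^-1 ^+ N :> R.
  elim: N => [|N IH]; first by rewrite big_nil expr0; ring.
  by rewrite big_nat_recr//= IH exprS; field.
by rewrite gerBl mulr_ge0 ?exprn_ge0 ?invr_ge0.
Qed.

End Psi2Moment.

(** * Rounding and truncation to a finite grid *)

Section Discretization.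
Context {R : realType}.
Variables (M eps : R).
Hypotheses (M0 : 0 <= M) (eps0 : 0 < eps).

Definition grid : finType := (bool * 'I_(Num.truncn (M / eps)).+1)%type.

Definition grid_val (k : grid) : R := (-1) ^+ k.1 * (eps * k.2%:R).

Definition grid0 : grid := (false, ord0).

(* Rounding is towards 0, so that it does not increase absolute values. *)
Definition to_grid (x : R) : grid :=
  if `|x| <= M then (x < 0, inord (Num.truncn (`|x| / eps))) else grid0.

Lemma grid_val0 : grid_val grid0 = 0.
Proof. by rewrite /grid_val /= !mulr0. Qed.

Lemma grid_val_le (k : grid) : `|grid_val k| <= M.
Proof.
rewrite /grid_val normrM normr_sign mul1r ger0_norm ?mulr_ge0 ?(ltW eps0)//.
rewrite mulrC -ler_pdivlMr//.
have := ltn_ord k.2; rewrite ltnS truncn_ge_nat// divr_ge0//; exact: ltW.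
Qed.

Lemma to_grid_itv x : `|x| <= M ->
  [/\ eps * (to_grid x).2%:R <= `|x|, `|x| < eps * (to_grid x).2%:R + eps &
      grid_val (to_grid x) = Num.sg x * (eps * (to_grid x).2%:R) \/ x = 0 ].
Proof.
move=> xM; have := xM; rewrite /to_grid => -> /=.
have x0 : 0 <= `|x| / eps by rewrite divr_ge0 ?(ltW eps0).
have xN : (Num.truncn (`|x| / eps) < (Num.truncn (M / eps)).+1)%N.
  rewrite ltnS truncn_ge_nat ?divr_ge0 ?(ltW eps0)//.
  apply: le_trans (_ : `|x| / eps <= _); first by have /andP[] := truncn_itv x0.
  by rewrite ler_pM2r ?invr_gt0.
rewrite inordK//; have /andP[h1 h2] := truncn_itv x0.
split.
- by rewrite mulrC -ler_pdivlMr.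
- by move: h2; rewrite ltr_pdivrMr// -addn1 natrD mulrDl mul1r mulrC.
- rewrite /grid_val /= inordK//.
  by case: (ltrgt0P x) => h; [left; rewrite expr0 gtr0_sg|left; rewrite expr1 ltr0_sg|right].
Qed.

Lemma grid_val_to_grid_le x : `|grid_val (to_grid x)| <= `|x|.
Proof.
have [xM|xM] := boolP (`|x| <= M); last by rewrite /to_grid (negbTE xM) grid_val0 normr0.
have [h _ _] := to_grid_itv x xM.
by rewrite /grid_val normrM normr_sign mul1r ger0_norm// mulr_ge0// ltW.
Qed.

Lemma to_grid_close x : `|x| <= M -> `|x - grid_val (to_grid x)| <= eps.
Proof.
move=> xM; have [h1 h2 [->|->]] := to_grid_itv x xM; last first.
  have := grid_val_to_grid_le 0; rewrite normr0 normr_le0 => /eqP ->.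
  by rewrite subr0 normr0 ltW.
rewrite {1}[x]numEsg -mulrBr normrM.
have [->|x0] := eqVneq x 0; first by rewrite sgr0 normr0 mul0r ltW.
rewrite normr_sg x0 mul1r ger0_norm; last by rewrite subr_ge0.
lra.
Qed.

Lemma measurable_to_grid_fiber (k : grid) : measurable (to_grid @^-1` [set k]).
Proof.
(* Membership in the fibre, rewritten as a Boolean test made of order comparisons, whose
   measurability is immediate. *)
pose b (x : R) : bool := if `|x| <= M then (if k.1 then x < 0 else 0 <= x) && (k.2%:R <= `|x| / eps < k.2.+1%:R)
  else k == grid0.
have -> : to_grid @^-1` [set k] = setT `&` b @^-1` [set true].
  rewrite setTI; apply/seteqP; split => x /=; rewrite /b.
  - move=> <-; rewrite /to_grid; have [xM|xM] := boolP (`|x| <= M); last by rewrite eqxx.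
    have -> : (if x < 0 then x < 0 else 0 <= x) by case: (ltP x 0).
    have x0 : 0 <= `|x| / eps by rewrite divr_ge0 ?(ltW eps0).
    have xN : (Num.truncn (`|x| / eps) < (Num.truncn (M / eps)).+1)%N.
      rewrite ltnS truncn_ge_nat ?divr_ge0 ?(ltW eps0)//.
      apply: le_trans (_ : `|x| / eps <= _); first by have /andP[] := truncn_itv x0.
      by rewrite ler_pM2r ?invr_gt0.
    by rewrite inordK// truncn_itv.
  - rewrite /to_grid; case: ifP => xM; last by move/eqP.
    move=> /andP[xk h]; rewrite (truncn_def h) inord_val.
    have -> : (x < 0) = k.1 by move: xk; case: k.1 => [->//|x0]; rewrite ltNge x0.
    by case: (k).
have mb : measurable_fun setT b.
  have mn : measurable_fun setT (fun x : R => `|x|) by exact: normr_measurable.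
  apply: measurable_fun_ifT.
  - by apply: measurable_fun_ler.
  - apply: measurable_and.
      by case: (k.1); [exact: measurable_fun_ltr|exact: measurable_fun_ler].
    apply: measurable_and.
      apply: measurable_fun_ler => //; exact: measurable_funM.
    apply: measurable_fun_ltr => //; exact: measurable_funM.
  - by [].
exact: mb.
Qed.

End Discretization.

(** * Measurability and integration of finite-valued functions *)

Section FiniteValued.
Context {R : realType} {d} {T : measurableType d} (P : probability T R).
Context {S : finType} (W : T -> S).
Hypothesis mW : forall s, measurable (W @^-1` [set s]).

Lemma measurable_finite_valued (E : set S) : measurable (W @^-1` E).
Proof.
have -> : W @^-1` E = \bigcup_(s in E) (W @^-1` [set s]).
  by apply/seteqP; split => [w Ew|w [s Es /= ->]] //; exists (W w).
by apply: fin_bigcup_measurable => //; exact: finite_finset.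
Qed.

Lemma measurable_fun_finite_valued d' (U : measurableType d') (G : S -> U) :
  measurable_fun setT (fun w => G (W w)).
Proof. by move=> _ B mB; rewrite setTI; exact: (measurable_finite_valued (G @^-1` B)). Qed.

Lemma integral_finite_valued (pr : S -> R) (G : S -> R) :
  (forall s, P (W @^-1` [set s]) = (pr s)%:E) -> (forall s, 0 <= G s) ->
  (\int[P]_w (G (W w))%:E = (\sum_s pr s * G s)%:E)%E.
Proof.
move=> hpr G0.
have E1 w : ((G (W w))%:E = \sum_(s <- index_enum S) (G s)%:E * (\1_(W @^-1` [set s]) w)%:E)%E.
  rewrite (bigD1 (W w))//= big1 ?adde0 => [|s sW]; last first.
    rewrite indicE memNset ?mule0// => /= h; by rewrite h eqxx in sW.
  by rewrite indicE mem_set ?mule1.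
under eq_integral do rewrite E1.
rewrite ge0_integral_sum//; last 2 first.
- move=> s; apply: measurable_funeM; apply/measurable_EFinP; exact: measurable_indic.
- by move=> s w _; rewrite mule_ge0// lee_fin.
rewrite -sumEFin; apply: eq_bigr => s _.
rewrite ge0_integralZl_EFin//.
  by rewrite integral_indic// setIT [X in (_ * X)%E](hpr s) -EFinM mulrC.
by apply/measurable_EFinP; exact: measurable_indic.
Qed.

End FiniteValued.

(** * The given random matrix and its grid approximation *)

Section HermitianRandomMatrix.
Context {R : realType} {d} {T : measurableType d} (P : probability T R).
Variables (n : nat) (A B : T -> 'M[R]_n).
Local Notation I := ('I_n * 'I_n * bool)%type.
Local Notation D := (upper_index n).
Hypotheses (hherm : forall w, hermitian_pair (A w) (B w))
  (hind : mutually_independent P D (entry_rv A B))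
  (hmean : forall i, i \in D -> (\int[P]_w (entry_rv A B i w)%:E = 0)%E)
  (hpsi : forall i, i \in D -> (psi2norm P (entry_rv A B i) <= 1)%E).

(** Independence is given on the upper triangle only. Setting the other coordinates to 0 keeps the
    full index type, and their grid law is then a point mass. *)
Definition upper_entry (w : T) (i : I) : R := if i \in D then entry_rv A B i w else 0.

Lemma in_upper_index (j k : 'I_n) (b : bool) : ((j, k, b) \in D) = (j <= k)%N.
Proof. by rewrite inE. Qed.

Lemma herm_re_upper_entry w : herm_re (upper_entry w) = A w.
Proof.
apply/matrixP => j k; rewrite mxE /upper_entry !in_upper_index /entry_rv /=.
have [/matrixP/(_ j k)] := hherm w; rewrite mxE => h _.
have [jk|jk] := boolP (j <= k)%N; rewrite ?jk ?(negbTE jk)//.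
by rewrite (ltnW _)// ltnNge.
Qed.

Lemma herm_im_upper_entry w : herm_im (upper_entry w) = B w.
Proof.
apply/matrixP => j k; rewrite mxE /upper_entry !in_upper_index /entry_rv /=.
have [_ /matrixP/(_ j k)] := hherm w; rewrite !mxE => h.
case: (ltngtP j k) => [//|_|/val_inj jk]; first by rewrite h opprK.
by move: h; rewrite jk => h; lra.
Qed.

Lemma measurable_upper_entry i : measurable_fun setT (fun w => upper_entry w i).
Proof.
rewrite /upper_entry; case: (boolP (i \in D)) => // iD.
by have [h _] := hind; exact: h.
Qed.

Lemma upper_exp_moment i : (\int[P]_w (expR (upper_entry w i ^+ 2 / 16))%:E <= 2%:E)%E.
Proof.
rewrite /upper_entry; case: (boolP (i \in D)) => iD.
  by apply: psi2norm_exp_moment; [have [h _] := hind; exact: h|exact: hpsi].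
under eq_integral do rewrite expr0n mul0r expR0.
by rewrite integral_cst// mul1e (le_trans (probability_le1 _ _))// lee_fin ler1n.
Qed.

Section grid_approximation.
Variables (M eps : R).
Hypotheses (M0 : 0 <= M) (eps0 : 0 < eps).
Local Notation K := (grid M eps).
Local Notation val := (grid_val M eps).

Definition grid_entries (w : T) : {ffun I -> K} :=
  [ffun i => if i \in D then to_grid M eps (entry_rv A B i w) else grid0 M eps].

Definition grid_law (i : I) (k : K) : R :=
  if i \in D then fine (P (entry_rv A B i @^-1` (to_grid M eps @^-1` [set k])))
  else (k == grid0 M eps)%:R.

Let measurable_fiber i k : i \in D ->
  measurable (entry_rv A B i @^-1` (to_grid M eps @^-1` [set k])).
Proof.
move=> iD; have [h _] := hind; have := h i iD measurableT _ (measurable_to_grid_fiber M eps M0 eps0 k).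
by rewrite setTI.
Qed.

Lemma grid_entries_fiber s : grid_entries @^-1` [set s] =
  if [forall i, (i \notin D) ==> (s i == grid0 M eps)]
  then \big[setI/setT]_(i in D) (entry_rv A B i @^-1` (to_grid M eps @^-1` [set s i]))
  else set0.
Proof.
case: ifPn => [/forallP hs|/forallPn[i]].
  apply/seteqP; split => [w /= <-|w].
    by rewrite -bigcap_seq_cond => i /= /andP[_ iD]; rewrite ffunE iD.
  rewrite -bigcap_seq_cond => h /=; apply/ffunP => i; rewrite ffunE; case: ifPn => iD.
    by apply: h => /=; rewrite mem_index_enum.
  by apply/esym/eqP; exact: (implyP (hs i)).
rewrite negb_imply => /andP[iD si]; apply/seteqP; split => // w /= h.
by move: si; rewrite -h ffunE (negbTE iD) eqxx.
Qed.

Lemma measurable_grid_entries s : measurable (grid_entries @^-1` [set s]).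
Proof.
rewrite grid_entries_fiber; case: ifP => // _.
by apply: bigsetI_measurable => i iD; exact: measurable_fiber.
Qed.

Lemma grid_law_ge0 i k : 0 <= grid_law i k.
Proof. by rewrite /grid_law; case: ifP => // _; rewrite fine_ge0. Qed.

(** Independence applied to the fibres of the rounding map yields the product law; outside the
    triangle each factor is 0 or 1. *)
Lemma probability_grid_entries s :
  P (grid_entries @^-1` [set s]) = (\prod_i grid_law i (s i))%:E.
Proof.
rewrite grid_entries_fiber; case: ifPn => [/forallP hs|/forallPn[i]].
  have [_ ->] := hind; last by move=> i; exact: measurable_to_grid_fiber.
  rewrite -prodEFin [RHS]big_mkcond [LHS]big_mkcond; apply: eq_bigr => i _ /=.
  rewrite /grid_law; case: ifPn => iD.
    by rewrite fineK// fin_num_measure//; exact: measurable_fiber.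
  by rewrite (implyP (hs i) iD).
rewrite negb_imply => /andP[iD si]; rewrite measure0 (bigD1 i)//=.
by rewrite /grid_law (negbTE iD) (negbTE si) mul0r.
Qed.

Lemma integral_grid_entries (G : {ffun I -> K} -> R) : (forall s, 0 <= G s) ->
  (\int[P]_w (G (grid_entries w))%:E = (\sum_(s : {ffun I -> K}) (\prod_i grid_law i (s i)) * G s)%:E)%E.
Proof.
move=> G0; apply: integral_finite_valued => //; first exact: measurable_grid_entries.
exact: probability_grid_entries.
Qed.

Lemma integral_grid_entry i (g : K -> R) : (forall k, 0 <= g k) ->
  (\int[P]_w (g (grid_entries w i))%:E = (\sum_k grid_law i k * g k)%:E)%E.
Proof.
move=> g0; pose Wi w := grid_entries w i.
have mWi k : measurable (Wi @^-1` [set k]).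
  have -> : Wi @^-1` [set k] = grid_entries @^-1` (fun s : {ffun I -> K} => s i = k) by [].
  by apply: measurable_finite_valued; exact: measurable_grid_entries.
apply: (@integral_finite_valued _ _ _ P _ Wi mWi (grid_law i)) => // k.
rewrite /grid_law; case: ifPn => iD.
  rewrite fineK; last by rewrite fin_num_measure//; exact: measurable_fiber.
  by congr (P _); apply/seteqP; split => w /=; rewrite /Wi ffunE iD.
have -> : Wi @^-1` [set k] = if k == grid0 M eps then setT else set0.
  apply/seteqP; split => w /=; rewrite /Wi ffunE (negbTE iD).
    by move=> <-; rewrite eqxx.
  by case: eqP.
by case: ifP => _; rewrite ?measure0// probability_setT.
Qed.

Lemma sum_grid_law i : \sum_k grid_law i k = 1.
Proof.
have := integral_grid_entry i (fun=> 1) (fun=> ler01).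
have -> : (\int[P]_w 1%:E = 1%:E)%E.
  by rewrite integral_cst// mul1e; exact: probability_setT.
move=> -[] ->.
by apply: eq_bigr => k _; rewrite mulr1.
Qed.

Definition grid_vec (w : T) (i : I) : R := val (grid_entries w i).

Lemma grid_vec_le w i : `|grid_vec w i| <= `|upper_entry w i|.
Proof.
rewrite /grid_vec /upper_entry ffunE; case: ifP => _; first exact: grid_val_to_grid_le.
by rewrite grid_val0 lexx.
Qed.

Lemma grid_vec_close w i : `|upper_entry w i| <= M -> `|upper_entry w i - grid_vec w i| <= eps.
Proof.
rewrite /grid_vec /upper_entry ffunE; case: ifP => _; first exact: to_grid_close.
by move=> _; rewrite grid_val0 subr0 normr0 ltW.
Qed.

Lemma measurable_grid_fun (F : (I -> R) -> R) : measurable_fun setT (fun w => F (grid_vec w)).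
Proof.
exact: (measurable_fun_finite_valued grid_entries measurable_grid_entries _ _
  (fun s : {ffun I -> K} => F (fun i => val (s i)))).
Qed.

Lemma integral_grid_fun (F : (I -> R) -> R) : (forall x, 0 <= F x) ->
  (\int[P]_w (F (grid_vec w))%:E = (expect grid_law val (enum {: I}) F (fun=> 0))%:E)%E.
Proof.
move=> F0; rewrite (expect_sum_ffun _ _ _ (grid0 M eps)).
exact: (integral_grid_entries (fun s => F (fun i => val (s i)))).
Qed.

(** Rounding never increases absolute values, so the exponential moment is inherited. *)
Lemma grid_law_tail i : \sum_k grid_law i k * expR (val k ^+ 2 / 16) <= 2.
Proof.
rewrite -lee_fin -(integral_grid_entry i (fun k => expR (val k ^+ 2 / 16))) => [|k]; last exact: expR_ge0.
apply: le_trans (upper_exp_moment i); apply: ge0_le_integral => //.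
- apply/measurable_EFinP.
  exact: (measurable_grid_fun (fun x => expR (x i ^+ 2 / 16))).
- apply/measurable_EFinP; apply: measurableT_comp => //.
  by apply: measurable_funM => //; apply: measurable_funX; exact: measurable_upper_entry.
move=> w _; rewrite lee_fin ler_expR ler_pM2r ?invr_gt0//.
rewrite -[leLHS]real_normK ?num_real// -[leRHS]real_normK ?num_real//.
by rewrite lerXn2r ?nnegrE//; exact: grid_vec_le.
Qed.

End grid_approximation.

(** The function is the pointwise limit of its values at grid approximations of range k + 1 and mesh
    1 / (k + 1), which are finite-valued. This gives the measurability of the norm, a supremum over
    an uncountable set. *)
Lemma measurable_lipschitz_fun (f : (I -> R) -> R) (L : R) :
  (forall x y, `|f x - f y| <= L * \sum_i `|x i - y i|) ->
  measurable_fun setT (fun w => f (upper_entry w)).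
Proof.
move=> fL.
have L0 : 0 <= L * #|{: I}|%:R.
  have := fL (fun=> 1) (fun=> 0).
  under eq_bigr do rewrite subr0 normr1.
  by rewrite sumr_const; apply: le_trans.
have k0 (k : nat) : 0 <= k.+1%:R :> R by [].
have k1 (k : nat) : 0 < k.+1%:R^-1 :> R by rewrite invr_gt0 ltr0n.
apply: (@measurable_fun_cvg _ T R setT (fun k w => f (grid_vec k.+1%:R k.+1%:R^-1 w))).
  by move=> k; exact: measurable_grid_fun.
move=> w _; apply/cvgrPdist_le => e e0; near=> k.
apply: le_trans (fL _ _) _.
have kS : \sum_i `|upper_entry w i| <= k%:R by near: k; exact: nbhs_infty_ger.
have kC : L * #|{: I}|%:R / e <= k%:R by near: k; exact: nbhs_infty_ger.
have kk : k%:R <= k.+1%:R :> R by rewrite ler_nat.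
have close i : `|upper_entry w i - grid_vec k.+1%:R k.+1%:R^-1 w i| <= k.+1%:R^-1.
  apply: grid_vec_close => //.
  apply: le_trans kk; apply: le_trans kS.
  by rewrite (bigD1 i)//= lerDl sumr_ge0.
have Lp : 0 <= L \/ #|{: I}| = 0%N.
  case: (posnP #|{: I}|) => [->|I0]; [by right|left].
  by rewrite -(pmulr_lge0 _ (_ : 0 < #|{: I}|%:R)) ?ltr0n.
have S1 : L * \sum_i `|upper_entry w i - grid_vec k.+1%:R k.+1%:R^-1 w i| <=
    L * #|{: I}|%:R * k.+1%:R^-1.
  case: Lp => [L1|I0].
    rewrite -mulrA ler_wpM2l// mulr_natl -sumr_const; exact: ler_sum.
  rewrite big1 => [|i _]; first by rewrite mulr0 mulr_ge0 ?invr_ge0.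
  by have := card0_eq I0 i; rewrite inE.
apply: le_trans S1 _; rewrite ler_pdivrMr ?ltr0n// [leRHS]mulrC -ler_pdivrMr//.
exact: le_trans kC kk.
Unshelve. all: by end_near.
Qed.

Lemma normr_le_expR_sqr (x : R) : `|x| <= 3 * expR (x ^+ 2 / 32).
Proof.
apply: le_trans (_ : 3 * (1 + x ^+ 2 / 32) <= _); last first.
  by rewrite ler_wpM2l// expR_ge1Dx.
rewrite -(real_normK (num_real x)); move: (`|x|) => y.
have : 0 <= (y - 16 / 3) ^+ 2 by exact: sqr_ge0.
rewrite sqrrB; lra.
Qed.

Lemma measurable_exp_entry i : measurable_fun setT (fun w => expR (upper_entry w i ^+ 2 / 16)).
Proof.
apply: measurableT_comp => //; apply: measurable_funM => //.
by apply: measurable_funX; exact: measurable_upper_entry.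
Qed.

Lemma integrable_exp_entry i :
  P.-integrable setT (fun w => (expR (upper_entry w i ^+ 2 / 16))%:E).
Proof.
apply/integrableP; split; first by apply/measurable_EFinP; exact: measurable_exp_entry.
under eq_integral do rewrite abse_EFin ger0_norm ?expR_ge0//.
by apply: le_lt_trans (upper_exp_moment i) _; rewrite ltry.
Qed.

Lemma integrable_upper_entry i : P.-integrable setT (fun w => (upper_entry w i)%:E).
Proof.
apply: (le_integrable measurableT _ _ (integrableZl measurableT 3 (integrable_exp_entry i))).
  by apply/measurable_EFinP; exact: measurable_upper_entry.
move=> w _; have e0 : 0 <= 3 * expR (upper_entry w i ^+ 2 / 16) by rewrite mulr_ge0 ?expR_ge0.
rewrite -EFinM !abse_EFin lee_fin (ger0_norm e0).
apply: le_trans (normr_le_expR_sqr _) _; rewrite ler_wpM2l// ler_expR.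
by have := sqr_ge0 (upper_entry w i); lra.
Qed.

Lemma integral_upper_entry i : (\int[P]_w (upper_entry w i)%:E = 0)%E.
Proof.
rewrite /upper_entry; case: (boolP (i \in D)) => iD; first exact: hmean.
by rewrite integral0.
Qed.

(** The original mean is 0, so the discretized one is at most delta times the exponential moment,
    itself at most 2. *)
Lemma grid_law_mean (M eps delta : R) (M0 : 0 <= M) (eps0 : 0 < eps) i : 0 <= delta ->
  (forall w, `|upper_entry w i - grid_vec M eps w i| <= delta * expR (upper_entry w i ^+ 2 / 16)) ->
  `|\sum_k grid_law M eps i k * grid_val M eps k| <= 2 * delta.
Proof.
move=> d0 close.
have side t : `|t| = 1 -> t * (\sum_k grid_law M eps i k * grid_val M eps k) <= 2 * delta.
  move=> t1.
  (* Adding M makes the integrand nonnegative, as the integration formula for finite-valued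
     functions requires. *)
  have g0 k : 0 <= t * grid_val M eps k + M.
    have : `|t * grid_val M eps k| <= M by rewrite normrM t1 mul1r grid_val_le.
    by rewrite ler_norml => /andP[h _]; rewrite -lerBlDr sub0r.
  pose E w := expR (upper_entry w i ^+ 2 / 16).
  have mE : measurable_fun setT E by exact: measurable_exp_entry.
  have mu_ := measurable_upper_entry i.
  have le1 w : t * grid_vec M eps w i + M <= t * upper_entry w i + (M + delta * E w).
    have : t * (grid_vec M eps w i - upper_entry w i) <= delta * E w.
      apply: le_trans (ler_norm _) _; rewrite normrM t1 mul1r distrC; exact: close.
    by rewrite mulrBr; lra.
  have := integral_grid_entry M eps M0 eps0 i (fun k => t * grid_val M eps k + M) g0.
  under [X in _ = X%:E]eq_bigr do rewrite mulrDr mulrCA.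
  rewrite big_split /= -mulr_sumr -mulr_suml sum_grid_law// mul1r => H.
  have H2 : (\int[P]_w (t * grid_vec M eps w i + M)%:E <=
      \int[P]_w (t * upper_entry w i + (M + delta * E w))%:E)%E.
    apply: ge0_le_integral => //.
    - by move=> w _; rewrite lee_fin; exact: g0.
    - apply/measurable_EFinP.
      exact: (measurable_grid_fun M eps M0 eps0 (fun x => t * x i + M)).
    - apply/measurable_EFinP; apply: measurable_funD; first exact: measurable_funM.
      by apply: measurable_funD => //; exact: measurable_funM.
    - by move=> w _; rewrite lee_fin; exact: le1.
  have H3 : (\int[P]_w (t * upper_entry w i + (M + delta * E w))%:E <= (M + delta * 2)%:E)%E.
    under eq_integral do rewrite EFinD EFinM.
    have i1 : P.-integrable setT (fun w => t%:E * (upper_entry w i)%:E)%E.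
      by apply: integrableZl => //; exact: integrable_upper_entry.
    have i2 : P.-integrable setT (fun w => (M + delta * E w)%:E).
      under eq_fun do rewrite EFinD EFinM.
      apply: integrableD => //; first exact: finite_measure_integrable_cst.
      by apply: integrableZl => //; exact: integrable_exp_entry.
    rewrite integralD// integralZl//; last exact: integrable_upper_entry.
    rewrite integral_upper_entry mule0 add0e.
    under eq_integral do rewrite EFinD EFinM.
    rewrite ge0_integralD//; last 2 first.
    - by move=> w _; rewrite -EFinM lee_fin mulr_ge0 ?expR_ge0.
    - by apply: measurable_funeM; apply/measurable_EFinP.
    rewrite ge0_integralZl_EFin//; last 2 first.
    - by move=> w _; rewrite lee_fin expR_ge0.
    - by apply/measurable_EFinP.
    rewrite EFinD EFinM; apply: leeD.
      by rewrite integral_cst//= -[leRHS]mule1 lee_wpmul2l ?lee_fin// probability_le1.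
    by apply: lee_wpmul2l; [rewrite lee_fin|exact: upper_exp_moment].
  have : ((t * (\sum_k grid_law M eps i k * grid_val M eps k) + M)%:E <= (M + delta * 2)%:E)%E.
    by rewrite -H; exact: le_trans H2 H3.
  by rewrite lee_fin; lra.
rewrite ler_norml; have := side 1 (normr1 _); have := side (-1) (normrN1 _).
by rewrite mul1r mulN1r => h1 h2; apply/andP; split; lra.
Qed.

Lemma probability_le_integral (E : set T) (f : T -> R) : measurable E -> measurable_fun setT f ->
  (forall w, 0 <= f w) -> (forall w, E w -> 1 <= f w) -> (P E <= \int[P]_w (f w)%:E)%E.
Proof.
move=> mE mf f0 Ef.
have -> : P E = (\int[P]_w (\1_E w)%:E)%E by rewrite integral_indic// setIT.
apply: ge0_le_integral => //.
- by apply/measurable_EFinP.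
- by apply/measurable_EFinP.
- move=> w _; rewrite lee_fin indicE; have [wE|wE] := boolP (w \in E).
    by apply: Ef; rewrite inE in wE.
  exact: f0.
Qed.

(** * Choice of the truncation and mesh, and transfer of the bounds *)

Section constants.
Variable p : R.
Hypotheses (n2 : (2 <= n)%N) (p2 : 2 <= p).
Local Notation q := (p / (p - 1)).
Local Notation x := (n%:R^-1 : R).

Let p10 : 0 < p - 1. Proof. by have := p2; lra. Qed.
Let p0 : 0 < p. Proof. by have := p2; lra. Qed.
Let q1 : 1 <= q. Proof. by rewrite ler_pdivlMr//; lra. Qed.
Let q2 : q <= 2. Proof. by rewrite ler_pdivrMr//; have := p2; lra. Qed.
Let pq : p^-1 + q^-1 = 1. Proof. by field; rewrite !gt_eqF. Qed.
Let n0 : (0 < n)%N. Proof. exact: leq_trans n2. Qed.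
Let n0R : 0 < n%:R :> R. Proof. by rewrite ltr0n. Qed.
Let x0 : 0 < x. Proof. by rewrite invr_gt0. Qed.
Let x2 : x <= 2^-1. Proof. by rewrite lef_pV2 ?posrE// (ler_nat _ 2). Qed.
Let xk (k : nat) : x ^+ k <= 2^-1 ^+ k.
Proof. by apply: lerXn2r => //; rewrite nnegrE invr_ge0. Qed.
Let x4 : 16 * x ^+ 4 <= 1.
Proof.
have := xk 4.
have -> : 2^-1 ^+ 4 = 16^-1 :> R by field.
lra.
Qed.
Let ln0 : 2^-1 <= ln n%:R :> R.
Proof. by apply: le_trans half_le_ln2 _; rewrite ler_ln ?posrE// (ler_nat _ 2). Qed.
Let expR_ln_mul (k : nat) : expR (- (k%:R * ln n%:R)) = x ^+ k.
Proof. by rewrite expRN expRM_natl lnK ?posrE// exprVn. Qed.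

Let M : R := Num.sqrt (320 * ln n%:R).
Let eps : R := x ^+ 10.
Let delta : R := 6 * x ^+ 10.
Let M2 : M ^+ 2 = 320 * ln n%:R.
Proof. by apply: sqr_sqrtr; have := ln0; lra. Qed.
Let M0 : 0 <= M. Proof. exact: sqrtr_ge0. Qed.
Let eps0 : 0 < eps. Proof. exact: exprn_gt0. Qed.
Let delta0 : 0 <= delta. Proof. by rewrite mulr_ge0// ltW. Qed.
Local Notation Ex F := (expect (grid_law M eps) (grid_val M eps) (enum {: I}) F (fun=> 0)).

(** A single pointwise bound covers rounding and truncation. Beyond M the error is at most 2|u| <= 6
    e^(u^2 / 32), and half of the exponent u^2 / 16 is worth n^(-10) there, since M^2 / 32 = 10 ln
    n. *)
Lemma grid_vec_tail_close w i :
  `|upper_entry w i - grid_vec M eps w i| <= delta * expR (upper_entry w i ^+ 2 / 16).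
Proof.
set u := upper_entry w i.
have [uM|uM] := leP `|u| M.
  apply: le_trans (_ : eps <= _); first exact: grid_vec_close.
  have e1 : 1 <= expR (u ^+ 2 / 16) by rewrite -expR0 ler_expR divr_ge0 ?sqr_ge0.
  apply: le_trans (_ : delta * 1 <= _); last by rewrite ler_wpM2l.
  by rewrite /delta -/eps mulr1; have := ltW eps0; lra.
apply: le_trans (_ : `|u| + `|u| <= _).
  by apply: le_trans (ler_normB _ _) _; rewrite lerD2l grid_vec_le.
apply: le_trans (_ : 6 * expR (u ^+ 2 / 32) <= _).
  by have := normr_le_expR_sqr u; lra.
rewrite /delta -mulrA ler_wpM2l// -expR_ln_mul -expRD ler_expR.
have : M ^+ 2 <= u ^+ 2.
  by rewrite -(real_normK (num_real u)) lerXn2r ?nnegrE// ltW.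
rewrite M2; lra.
Qed.

(** The total error in the norm. Its mean is at most 48 n^(-8) <= 3 n^(-4), from 2 n^2 coordinates;
    this bounds both the shift of the expectation and, by Markov's inequality, the probability that
    the error exceeds 1. *)
Let psi (w : T) : R := \sum_i (2 * delta) * expR (upper_entry w i ^+ 2 / 16).

Let psi0 w : 0 <= psi w.
Proof. by apply: sumr_ge0 => i _; rewrite mulr_ge0 ?expR_ge0// mulr_ge0. Qed.

Let mpsi : measurable_fun setT psi.
Proof.
by apply: measurable_sum => i; apply: measurable_funM => //; exact: measurable_exp_entry.
Qed.

Let card_index : #|{: I}|%:R = 2 * n%:R ^+ 2 :> R.
Proof. by rewrite !card_prod card_ord card_bool !natrM; ring. Qed.

Let psi_int : (\int[P]_w (psi w)%:E <= (3 * x ^+ 4)%:E)%E.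
Proof.
rewrite /psi; under eq_integral do rewrite -sumEFin.
rewrite ge0_integral_sum//; last 2 first.
- move=> i; apply/measurable_EFinP; apply: measurable_funM => //; exact: measurable_exp_entry.
- by move=> i w _; rewrite lee_fin !mulr_ge0 ?expR_ge0.
apply: (@le_trans _ _ (\sum_(i : I) (2 * delta * 2)%:E)%E).
  apply: lee_sum => i _; under eq_integral do rewrite EFinM.
  rewrite ge0_integralZl_EFin//; last 2 first.
  - by apply/measurable_EFinP; exact: measurable_exp_entry.
  - by rewrite mulr_ge0.
  by rewrite (EFinM (2 * delta)) lee_wpmul2l ?lee_fin ?mulr_ge0//; exact: upper_exp_moment.
rewrite sumEFin lee_fin.
have -> : \sum_(i : I) 2 * delta * 2 = #|{: I}|%:R * (2 * delta * 2).
  by rewrite [RHS]mulr_natl -sumr_const.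
rewrite card_index.
have -> : 2 * n%:R ^+ 2 * (2 * delta * 2) = 48 * (x ^+ 4 * x ^+ 4).
  by rewrite /delta; field; rewrite gt_eqF.
have : 0 <= x ^+ 4 * (1 - 16 * x ^+ 4) by rewrite mulr_ge0 ?subr_ge0// exprn_ge0// ltW.
lra.
Qed.

Let N (w : T) : R := opnorm q p (A w) (B w).
Let Ng (w : T) : R := herm_norm p q (grid_vec M eps w).
Let m : R := Ex (herm_norm p q).

Let NE w : N w = herm_norm p q (upper_entry w).
Proof. by rewrite /herm_norm herm_re_upper_entry herm_im_upper_entry. Qed.

Let N_close w : `|N w - Ng w| <= psi w.
Proof.
rewrite NE; apply: le_trans (herm_norm_sub_le p q p2 q1 q2 pq _ _) _.
rewrite mulr_sumr; apply: ler_sum => i _; rewrite -mulrA ler_wpM2l//.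
exact: grid_vec_tail_close.
Qed.

Let N0 w : 0 <= N w. Proof. exact: opnorm_ge0. Qed.
Let Ng0 w : 0 <= Ng w. Proof. exact: herm_norm_ge0. Qed.

Let mN : measurable_fun setT N.
Proof.
have -> : N = fun w => herm_norm p q (upper_entry w) by apply/funext => w; exact: NE.
apply: (measurable_lipschitz_fun _ 2) => u v; exact: herm_norm_sub_le.
Qed.

Let mNg : measurable_fun setT Ng.
Proof. exact: measurable_grid_fun. Qed.

Let Ng_int : (\int[P]_w (Ng w)%:E = m%:E)%E.
Proof. by apply: integral_grid_fun => // v; exact: herm_norm_ge0. Qed.

Let shift_int (f g : T -> R) : measurable_fun setT f -> measurable_fun setT g ->
  (forall w, 0 <= f w) -> (forall w, 0 <= g w) -> (forall w, f w <= g w + psi w) ->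
  (\int[P]_w (f w)%:E <= \int[P]_w (g w)%:E + 1%:E)%E.
Proof.
move=> mf mg f0 g0 fg.
apply: (@le_trans _ _ (\int[P]_w ((g w)%:E + (psi w)%:E))%E).
  apply: ge0_le_integral => //.
  - by move=> w _; rewrite lee_fin.
  - by apply/measurable_EFinP.
  - by apply: emeasurable_funD; apply/measurable_EFinP.
  - by move=> w _; rewrite -EFinD lee_fin.
rewrite ge0_integralD//; last 4 first.
- by move=> w _; rewrite lee_fin.
- by apply/measurable_EFinP.
- by move=> w _; rewrite lee_fin.
- by apply/measurable_EFinP.
apply: leeD => //; apply: le_trans psi_int _; rewrite lee_fin.
by have := x4; lra.
Qed.

Let EN_le : (\int[P]_w (N w)%:E <= (m + 1)%:E)%E.
Proof.
rewrite EFinD -Ng_int; apply: shift_int => // w.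
by have := N_close w; rewrite ler_norml => /andP[_]; rewrite lerBlDl.
Qed.

Let m_le : (m%:E <= \int[P]_w (N w)%:E + 1%:E)%E.
Proof.
rewrite -Ng_int; apply: shift_int => // w.
by have := N_close w; rewrite ler_norml => /andP[h _]; lra.
Qed.

Lemma opnorm_mean_fin_num : (\int[P]_w (N w)%:E)%E \is a fin_num.
Proof.
rewrite ge0_fin_numE; last by apply: integral_ge0 => w _; rewrite lee_fin.
by apply: le_lt_trans EN_le _; rewrite ltry.
Qed.

Let mean_eta : #|{: I}|%:R * (2 * delta) ^+ 2 <= 1.
Proof.
rewrite card_index.
have -> : 2 * n%:R ^+ 2 * (2 * delta) ^+ 2 = 288 * x ^+ 18.
  by rewrite /delta; field; rewrite gt_eqF.
have := xk 18.
have -> : 2^-1 ^+ 18 = 2^-1 ^+ 9 * 2^-1 ^+ 9 :> R by rewrite -exprD.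
have -> : 2^-1 ^+ 9 = 512^-1 :> R by field.
lra.
Qed.

Lemma m_le_mean_const : m <= mean_const * (Num.sqrt p * n%:R `^ p^-1).
Proof.
apply: (expect_herm_norm_le p q p2 q1 q2 pq _ _ (2 * delta)) => //.
- exact: grid_law_ge0.
- by move=> i; exact: sum_grid_law.
- by move=> i; exact: grid_law_tail.
- by move=> i; apply: grid_law_mean => // w; exact: grid_vec_tail_close.
Qed.

(** With c = 1 / (32 M^2), the exponential moment is at most e^(16 M^2) = n^5120; the threshold 5124
    leaves n^(-4). *)
Let tail_bound (e : R) : e = 1 \/ e = -1 ->
  (P [set w | (5124 * ln n%:R < e * (Ng w - m))%R] <= (x ^+ 4)%:E)%E.
Proof.
move=> eE; set E := [set w | _].
have mE : measurable E.
  exact: (measurable_finite_valued (grid_entries M eps)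
    (measurable_grid_entries M eps M0 eps0)
    (fun s : {ffun I -> grid M eps} =>
       5124 * ln n%:R < e * (herm_norm p q (fun i => grid_val M eps (s i)) - m))).
pose F (v : I -> R) : R := expR (- (5124 * ln n%:R)) * expR (e * (herm_norm p q v - m)).
have F0 v : 0 <= F v by rewrite mulr_ge0 ?expR_ge0.
have mF : measurable_fun setT (fun w => F (grid_vec M eps w)) by exact: measurable_grid_fun.
have key (a b : R) : a < b -> 1 <= expR (- a) * expR b.
  by move=> ab; rewrite -expRD; apply: le_trans (expR_ge1Dx _); lra.
have EF w : E w -> 1 <= F (grid_vec M eps w) by exact: key.
apply: le_trans (probability_le_integral E _ mE mF (fun w => F0 _) EF) _.
rewrite integral_grid_fun// lee_fin expectZ.
have ln1 : 0 < ln n%:R :> R by apply: lt_le_trans ln0.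
pose c : R := (32 * M ^+ 2)^-1.
have M32 : 0 < 32 * M ^+ 2 by rewrite M2; lra.
have c0 : 0 < c by rewrite invr_gt0.
have cM : c * (32 * M ^+ 2) <= 1 by rewrite mulVf// gt_eqF.
have cE : 1 / (2 * c) = 5120 * ln n%:R.
  have MN0 : M != 0 by apply: contraTneq M32 => ->; rewrite expr0n mulr0 ltxx.
  have -> : 1 / (2 * c) = 16 * M ^+ 2 by rewrite /c; field.
  by rewrite M2; lra.
have h : Ex (fun v => expR (e * (herm_norm p q v - m))) <= expR (1 / (2 * c)).
  apply: (herm_norm_concentration p q p2 q1 q2 pq _ _ _ _ c M (grid0 M eps)) => //.
  - exact: grid_law_ge0.
  - by move=> i; exact: sum_grid_law.
  - by move=> k; exact: grid_val_le.
rewrite cE in h.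
apply: le_trans (ler_wpM2l (expR_ge0 _) h) _.
rewrite -expRD -expR_ln_mul ler_expR; lra.
Qed.

Theorem opnorm_mean_le :
  (\int[P]_w (N w)%:E <= ((mean_const + 1) * (Num.sqrt p * n%:R `^ p^-1))%:E)%E.
Proof.
apply: le_trans EN_le _; rewrite lee_fin mulrDl mul1r; apply: lerD; first exact: m_le_mean_const.
have s1 : 1 <= Num.sqrt p by rewrite -sqrtr1 ler_sqrt; have := p2; lra.
have n1 : 1 <= n%:R `^ p^-1 :> R.
  by rewrite -[leLHS](powRr0 (n%:R : R)) ler_powR ?ler1n// invr_ge0 ltW.
by rewrite -[leLHS]mul1r ler_pM.
Qed.

Lemma measurable_opnorm : measurable_fun setT N.
Proof. exact: mN. Qed.

(** Replacing the norm and its mean by their discretized versions costs at most 1 each off the event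
    psi > 1, and 2 <= 4 ln n; hence 5128 = 5124 + 4. The probabilities add up to 1 + 1 + 3 times
    n^(-4). *)
Theorem opnorm_deviation_le :
  (P [set w | (5128 * ln n%:R < `|N w - fine (\int[P]_w (N w)%:E)%E|)%R] <= (5 * n%:R ^- 4)%:E)%E.
Proof.
set EN := fine _.
have h1 : EN <= m + 1 by rewrite -lee_fin fineK// opnorm_mean_fin_num.
have h2 : m <= EN + 1 by rewrite -lee_fin EFinD fineK// opnorm_mean_fin_num.
pose E1 := [set w | 5124 * ln n%:R < 1 * (Ng w - m)].
pose E2 := [set w | 5124 * ln n%:R < -1 * (Ng w - m)].
pose E3 := [set w | 1 < psi w].
have mle (f g : T -> R) : measurable_fun setT f -> measurable_fun setT g ->
    measurable [set w | f w < g w].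
  move=> mf mg; rewrite -[X in measurable X]setTI.
  have h := measurable_fun_ltr mf mg.
  exact: (h measurableT [set true]).
have mE1 : measurable E1 by apply: mle => //; apply: measurable_funM => //; exact: measurable_funB.
have mE2 : measurable E2 by apply: mle => //; apply: measurable_funM => //; exact: measurable_funB.
have mE3 : measurable E3 by apply: mle.
have mE : measurable [set w | (5128 * ln n%:R < `|N w - EN|)%R].
  apply: mle => //; apply: measurableT_comp => //; exact: measurable_funB.
apply: (@le_trans _ _ (P (E1 `|` E2 `|` E3))).
  apply: le_measure; rewrite ?inE//; first by do !apply: measurableU.
  move=> w /= hw; have [h3|h3] := leP (psi w) 1; last by right.
  left; have := N_close w; rewrite ler_norml => /andP[a1 a2].
  move: hw; rewrite lter_normr => /orP[b|b]; [left|right]; rewrite /E1 /E2 /=; have := ln0; lra.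
apply: le_trans (measureU2 _ _ _) _ => //; first exact: measurableU.
apply: le_trans (leeD (measureU2 _ _ _) (lexx _)) _ => //.
have b1 := tail_bound 1 (or_introl erefl); have b2 := tail_bound (-1) (or_intror erefl).
have b3 : (P E3 <= (3 * x ^+ 4)%:E)%E.
  by apply: le_trans psi_int; apply: probability_le_integral => // w; exact: ltW.
apply: le_trans (leeD (leeD b1 b2) b3) _.
by rewrite -!EFinD lee_fin exprVn; lra.
Qed.

End constants.

End HermitianRandomMatrix.

(** * The three bounds with common constants *)

Theorem theorem6 (R : realType) :
  exists C K : R, 0 < C /\ 0 < K /\
  forall (n : nat) (p : R) (d : measure_display) (T : measurableType d)
         (P : probability T R) (A B : T -> 'M[R]_n),
    (2 <= n)%N -> 2 <= p ->
    (forall w, hermitian_pair (A w) (B w)) ->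
    mutually_independent P (upper_index n) (entry_rv A B) ->
    (forall i, i \in upper_index n ->
       (\int[P]_w (entry_rv A B i w)%:E = 0)%E /\
       (psi2norm P (entry_rv A B i) <= 1)%E) ->
    let p' := p / (p - 1) in
    let N := fun w => opnorm p' p (A w) (B w) in
    let EN := (\int[P]_w (N w)%:E)%E in
    (EN <= (C * Num.sqrt p * n%:R `^ p^-1)%:E)%E /\
    (P [set w | (C * ln n%:R < `|N w - fine EN|)%R] <= (K * n%:R ^- 4)%:E)%E /\
    (P [set w | (C * Num.sqrt (p * ln n%:R) * n%:R `^ p^-1 < N w)%R]
       <= (K * n%:R ^- 4)%:E)%E.
Proof.
have mc0 : 0 < mean_const + 1 :> R.
  rewrite /mean_const; have := expR_gt0 (1 : R); move: (expR 1) => e; lra.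
set c : R := mean_const + 1 in mc0.
have [D DE] : exists D : R, D = 5128 by exists 5128.
(* In the third bound, D covers the deviation and 2c covers the mean, since sqrt p <= 2 sqrt (p log
   n). *)
exists (2 * c + D), 5; split; first by lra.
split; first by rewrite ltr0n.
move=> n p d T P A B n2 p2 hh hi hm p' N EN.
have hmean i : i \in upper_index n -> (\int[P]_w (entry_rv A B i w)%:E = 0)%E.
  by move=> /hm[].
have hpsi i : i \in upper_index n -> (psi2norm P (entry_rv A B i) <= 1)%E.
  by move=> /hm[].
have mean_le : (EN <= (c * (Num.sqrt p * n%:R `^ p^-1))%:E)%E by exact: opnorm_mean_le.
have dev_le : (P [set w | (D * ln n%:R < `|N w - fine EN|)%R] <= (5 * n%:R ^- 4)%:E)%E.
  by rewrite DE; exact: opnorm_deviation_le.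
have mN : measurable_fun setT N by apply: (measurable_opnorm P).
have n0 : 0 < n%:R :> R by rewrite ltr0n (leq_trans _ n2).
have p0 : 0 < p by lra.
have l1 : 2^-1 <= ln n%:R :> R.
  by apply: le_trans half_le_ln2 _; rewrite ler_ln ?posrE// (ler_nat _ 2).
set l : R := ln n%:R in dev_le l1 *.
have l0 : 0 < l by lra.
set u : R := n%:R `^ p^-1 in mean_le *.
have s0 : 0 <= Num.sqrt p * u by rewrite mulr_ge0 ?sqrtr_ge0 ?powR_ge0.
have fEN : fine EN <= c * (Num.sqrt p * u).
  by rewrite -lee_fin fineK//; exact: opnorm_mean_fin_num.
have mD (f g : T -> R) : measurable_fun setT f -> measurable_fun setT g ->
    measurable [set w | f w < g w].
  move=> mf mg; rewrite -[X in measurable X]setTI; have h := measurable_fun_ltr mf mg.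
  exact: (h measurableT [set true]).
have mdev (t : R) : measurable [set w | (t < `|N w - fine EN|)%R].
  by apply: mD => //; apply: measurableT_comp => //; exact: measurable_funB.
(* [l <= sqrt (p l) n^(1/p)] because [sqrt t <= e^t] at [t = l / p]. *)
have lsu : l <= Num.sqrt (p * l) * u.
  have uE : u = expR (l / p) by rewrite /u /powR gt_eqF// mulrC.
  have t0 : 0 <= l / p by rewrite divr_ge0 ?ltW.
  have st : Num.sqrt (l / p) <= u.
    rewrite uE; apply: le_trans (expR_ge1Dx _).
    have := sqr_sqrtr t0; set y := Num.sqrt _ => <-.
    by have := sqr_ge0 (y - 2^-1); have := sqr_ge0 y; rewrite sqrrB; lra.
  apply: le_trans (_ : Num.sqrt (p * l) * Num.sqrt (l / p) <= _); last first.
    by rewrite ler_wpM2l ?sqrtr_ge0.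
  rewrite -sqrtrM ?mulr_ge0 ?(ltW p0) ?(ltW l0)//.
  have -> : p * l * (l / p) = l ^+ 2 by field; rewrite gt_eqF.
  by rewrite sqrtr_sqr gtr0_norm.
(* Already for n = 2, log n >= 1/2 >= 1/4, so 2 sqrt (log n) >= 1. *)
have sl : Num.sqrt p * u <= 2 * (Num.sqrt (p * l) * u).
  rewrite mulrA ler_wpM2r ?powR_ge0// sqrtrM ?(ltW p0)// mulrCA -[leLHS]mulr1 ler_wpM2l ?sqrtr_ge0//.
  rewrite -ler_pdivrMl// mulr1 -[leLHS]ger0_norm ?invr_ge0// -sqrtr_sqr ler_sqrt ?(ltW l0)//.
  by apply: le_trans l1; rewrite expr2; lra.
split; [|split].
- apply: le_trans mean_le _; rewrite lee_fin -mulrA ler_wpM2r//; lra.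
- apply: le_trans dev_le; apply: le_measure; rewrite ?inE// => w /=.
  by apply: le_lt_trans; rewrite ler_wpM2r ?(ltW l0)//; lra.
- apply: le_trans dev_le; apply: le_measure; rewrite ?inE//; first exact: mD.
  move=> w /= hw; apply: lt_le_trans (ler_norm _); rewrite ltrBrDr.
  apply: le_lt_trans hw; have := ler_wpM2l (ltW mc0) sl; have D0 : 0 <= D by lra.
  have := ler_wpM2l D0 lsu; move: fEN; rewrite -mulrA.
  move: (Num.sqrt (p * l) * u) (Num.sqrt p * u) (fine EN) => v y e; lra.
Qed.
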